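(* Let $(E,\omega)$ be a locally finite weighted graph, and let $(E(\omega)_1,C(\omega)^1)$ be the bipartite separated graph associated to it. Then there are natural $*$-isomorphisms $$L^{\mathrm{ab}}(E,\omega)\cong LV^{\mathrm{ab}}(E(\omega)_1,C(\omega)^1)\cong \overline V\,L^{\mathrm{ab}}(E(\omega)_1,C(\omega)^1)\,\overline V,$$ where $\overline V=\pi_\infty(V)\in M(L^{\mathrm{ab}}(E(\omega)_1,C(\omega)^1))$.
   Context: Fix a field $K$ with an involution $*$. All algebras are $*$-algebras over $K$ (not necessarily unital), and all presentations are taken in the category of $*$-algebras. $M(A)$ is the multiplier algebra of $A$. A directed graph is $E=(E^0,E^1,r,s)$; it is row-finite if all $s^{-1}(v)$ are finite, locally finite if all $s^{-1}(v)$ and $r^{-1}(v)$ are finite. $E^0_{\mathrm{reg}}=\{v: s^{-1}(v)\ne\emptyset\}$. A weighted graph $(E,\omega)$ is a row-finite graph $E$ with no isolated vertices (no $v$ with $s^{-1}(v)=r^{-1}(v)=\emptyset$) with a map $\omega\colon E^1\to\mathbb N=\{1,2,\dots\}$; it is locally finite if $E$ is. Put $\omega(v)=\max\{\omega(e):e\in s^{-1}(v)\}$ for $v\in E^0_{\mathrm{reg}}$ and $\omega(v)=0$ for a sink $v$. $L_1(E,\omega)$ is the $*$-algebra generated by $\{v,e_i\mid v\in E^0,e\in E^1,1\le i\le\omega(e)\}$ subject to: (1) $uv=\delta_{u,v}u$, $v=v^*$; (2) $s(e)e_i=e_i=e_ir(e)$; (3) $e_ie_j^*=0$ for $e\in E^1$,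 $1\le i,j\le\omega(e)$, $i\ne j$; (4) $e_i^*f_i=0$ for $e,f\in s^{-1}(v)$, $e\neq f$, $v\in E^0$, $1\le i\le\min\{\omega(e),\omega(f)\}$; (5) $\sum_{e\in s^{-1}(v),\,\omega(e)\ge i}e_ie_i^*=v$ for $v\in E^0_{\mathrm{reg}}$, $1\le i\le\omega(v)$; (6) $\sum_{1\le i\le\omega(e)}e_i^*e_i=r(e)$ for $e\in E^1$. The $e_i$ are partial isometries ($e_ie_i^*e_i=e_i$). Tame algebras: for an element $u$ of a $*$-algebra put $e(u)=uu^*$. A set $F$ of partial isometries of $A$ is tame if $e(u),e(u')$ commute for all $u,u'$ in the multiplicative $*$-subsemigroup $U$ generated by $F$. If $A$ is generated as a $*$-algebra by a set $F$ of partial isometries, the universal tame $*$-algebra of $A$ with respect to $F$ is $A^{\mathrm{ab}}=A/J$, where $J$ is the ideal generated by all $[e(u),e(u')]$, $u,u'\in U$. The abelianized Leavitt path algebra $L^{\mathrm{ab}}(E,\omega)$ is the universal tame $*$-algebra of $L_1(E,\omega)$ with respect to $E^0\cup\{e_i:e\in E^1,1\le i\le\omega(e)\}$. A separated graph is a pair $(F,D)$ with $F$ a directed graph and $D=\bigcup_{v\in F^0}D_v$, $D_v$ a partition of $s^{-1}(v)$ into nonempty subsets. It is bipartite if $F^0=F^{0,0}\sqcup F^{0,1}$ with $s(F^1)\subseteq F^{0,0}$, $r(F^1)\subseteq F^{0,1}$. $L(F,D)$ is the $*$-algebra with generators $F^0\sqcup F^1$ and relations $vv'=\delta_{v,v'}v$,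 $v=v^*$; $s(e)e=e=er(e)$; $e^*f=\delta_{e,f}r(e)$ for $e,f\in X$, $X\in D$; $v=\sum_{e\in X}ee^*$ for every finite $X\in D_v$. $L^{\mathrm{ab}}(F,D)$ is its universal tame $*$-algebra with respect to $F^0\sqcup F^1$, and $\pi_\infty\colon L(F,D)\to L^{\mathrm{ab}}(F,D)$ the quotient map. For a row-finite bipartite $(F,D)$ with $s(F^1)=F^{0,0}$, $r(F^1)=F^{0,1}$, $LV(F,D)$ is the universal $*$-algebra with generators $\{p_v\}_{v\in F^{0,0}}$ and $\{\tau(e,f): e,f\in F^1,\ r(e)=r(f)\}$ and relations: $p_vp_{v'}=\delta_{v,v'}p_v$, $p_v^*=p_v$; $\tau(e,f)^*=\tau(f,e)$; $\tau(e,f)p_{s(f)}=p_{s(e)}\tau(e,f)=\tau(e,f)$; $\tau(e,f)\tau(g,h)=\delta_{f,g}\tau(e,h)$ for $f,g$ in the same set $Y\in D$; $p_v=\sum_{e\in Y}\tau(e,e)$ for $v\in F^{0,0}$, $Y\in D_v$. It is identified with $VL(F,D)V$, where $V=\sum_{v\in F^{0,0}}v\in M(L(F,D))$, via $p_v=v$, $\tau(e,f)=ef^*$. $LV^{\mathrm{ab}}(F,D)$ is the universal tame $*$-algebra of $LV(F,D)$ with respect to $\{p_v\}\sqcup\{\tau(x,y)\}$. By $\pi_\infty(V)$ is meant the multiplier $\sum_{v\in F^{0,0}}\pi_\infty(v)$ of $L^{\mathrm{ab}}(F,D)$; the corner $\pi_\infty(V)L^{\mathrm{ab}}(F,D)\pi_\infty(V)$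 is the linear span of the elements $\pi_\infty(v)x\pi_\infty(v')$, $v,v'\in F^{0,0}$, $x\in L^{\mathrm{ab}}(F,D)$. For a locally finite weighted graph $(E,\omega)$, $(E(\omega)_1,C(\omega)^1)$ is the bipartite separated graph with $E(\omega)_1^{0,0}=E^0$, $E(\omega)_1^{0,1}=\{v(e,i):e\in E^1,1\le i\le\omega(e)\}$, and for $v\in E^0$, $C(\omega)^1_v=\{X(v,1),\dots,X(v,\omega(v))\}\cup\{X(e)\mid e\in E^1,r(e)=v\}$, where for $1\le i\le\omega(v)$, $X(v,i)=\{\alpha^i(e): e\in s^{-1}(v),\ \omega(e)\ge i\}$ with $s(\alpha^i(e))=s(e)=v$, $r(\alpha^i(e))=v(e,i)$; and for $e\in E^1$ with $r(e)=v$, $X(e)=\{\alpha^e(i):1\le i\le\omega(e)\}$ with $s(\alpha^e(i))=r(e)=v$, $r(\alpha^e(i))=v(e,i)$. All the listed edges are pairwise distinct. *)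

(* Defs.v *)
From HB Require Import structures.
From mathcomp Require Import all_boot all_order all_algebra.
From mathcomp Require Import boolp classical_sets functions cardinality fsbigop.

Set Implicit Arguments.
Unset Strict Implicit.
Unset Printing Implicit Defensive.

Import GRing.Theory.

Local Open Scope classical_set_scope.
Local Open Scope quotient_scope.
Local Open Scope ring_scope.

HB.mixin Record isStarAlg (K : fieldType) (conj : involutive_rmorphism K) A
    of GRing.Lmodule K A := {
  sa_mul : A -> A -> A;
  sa_star : A -> A;
  sa_mulA : associative sa_mul;
  sa_mulDl : forall x y z : A, sa_mul (x + y) z = sa_mul x z + sa_mul y z;
  sa_mulDr : forall x y z : A, sa_mul x (y + z) = sa_mul x y + sa_mul x z;
  sa_scalel : forall (k : K) (x y : A), sa_mul (k *: x) y = k *: sa_mul x y;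
  sa_scaler : forall (k : K) (x y : A), sa_mul x (k *: y) = k *: sa_mul x y;
  sa_starK : involutive sa_star;
  sa_starD : {morph sa_star : x y / x + y};
  sa_starZ : forall (k : K) (x : A), sa_star (k *: x) = conj k *: sa_star x;
  sa_starM : forall x y : A, sa_star (sa_mul x y) = sa_mul (sa_star y) (sa_star x)
}.

#[short(type="starAlgType")]
HB.structure Definition StarAlg (K : fieldType) (conj : involutive_rmorphism K) :=
  {A of GRing.Lmodule K A & isStarAlg K conj A}.

(* There is no unit, so the product is not the one of a [pzRingType]; [^*]
   replaces the notation for the conjugate in a [numClosedFieldType]. *)
Reserved Notation "x ** y" (at level 40, left associativity).
Notation "x ** y" := (sa_mul x y) : ring_scope.
Notation "x ^*" := (sa_star x) : ring_scope.

Section StarAlgTheory.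
Variables (K : fieldType) (conj : involutive_rmorphism K) (A : starAlgType conj).
Implicit Types x y : A.

Lemma sa_mul0l x : 0 ** x = 0.
Proof. by rewrite -(scale0r (0 : A)) sa_scalel !scale0r. Qed.

Lemma sa_mul0r x : x ** 0 = 0.
Proof. by rewrite -(scale0r (0 : A)) sa_scaler !scale0r. Qed.

Lemma sa_mulNl x y : (- x) ** y = - (x ** y).
Proof. by rewrite -!scaleN1r sa_scalel. Qed.

Lemma sa_mulNr x y : x ** (- y) = - (x ** y).
Proof. by rewrite -!scaleN1r sa_scaler. Qed.

Lemma sa_mulBl x y z : (x - y) ** z = x ** z - y ** z.
Proof. by rewrite sa_mulDl sa_mulNl. Qed.

Lemma sa_mulBr x y z : x ** (y - z) = x ** y - x ** z.
Proof. by rewrite sa_mulDr sa_mulNr. Qed.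

Lemma sa_star0 : (0 : A)^* = 0.
Proof. by rewrite -(scale0r (0 : A)) sa_starZ rmorph0 !scale0r. Qed.

Lemma sa_starN x : (- x)^* = - x^*.
Proof. by rewrite -!scaleN1r sa_starZ rmorphN1. Qed.

Lemma sa_starB x y : (x - y)^* = x^* - y^*.
Proof. by rewrite sa_starD sa_starN. Qed.

End StarAlgTheory.

Definition star_hom (K : fieldType) (conj : involutive_rmorphism K)
    (A B : starAlgType conj) (f : A -> B) : Prop :=
  [/\ linear f, {morph f : x y / x ** y >-> x ** y} & {morph f : x / x^* >-> x^*}].

Definition star_iso (K : fieldType) (conj : involutive_rmorphism K)
    (A B : starAlgType conj) (f : A -> B) : Prop :=
  star_hom f /\ bijective f.

Record starIdeal (K : fieldType) (conj : involutive_rmorphism K)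
    (A : starAlgType conj) := StarIdeal {
  ideal_set :> A -> Prop;
  ideal0 : ideal_set 0;
  idealD : forall x y, ideal_set x -> ideal_set y -> ideal_set (x + y);
  idealZ : forall (k : K) x, ideal_set x -> ideal_set (k *: x);
  idealMl : forall a x, ideal_set x -> ideal_set (a ** x);
  idealMr : forall x a, ideal_set x -> ideal_set (x ** a);
  ideal_star : forall x, ideal_set x -> ideal_set (x^*)
}.

Section Quotient.
Variables (K : fieldType) (conj : involutive_rmorphism K).
Variables (A : starAlgType conj) (J : starIdeal A).

Lemma idealN x : J x -> J (- x).
Proof. by move=> Jx; rewrite -scaleN1r; apply: idealZ. Qed.

Definition idealrel : rel A := fun x y => `[< J (x - y) >].

Lemma idealrel_refl : reflexive idealrel.
Proof. by move=> x; apply/asboolP; rewrite subrr; apply: ideal0. Qed.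

Lemma idealrel_sym : symmetric idealrel.
Proof.
by move=> x y; apply/asboolP/asboolP=> /idealN; rewrite opprB.
Qed.

Lemma idealrel_trans : transitive idealrel.
Proof.
move=> y x z /asboolP Jxy /asboolP Jyz; apply/asboolP.
by rewrite -(subrKA y); apply: idealD.
Qed.

Canonical idealrel_equiv := EquivRel idealrel idealrel_refl idealrel_sym idealrel_trans.

Definition quot := {eq_quot idealrel}.

HB.instance Definition _ := Choice.on quot.

Definition qpi (x : A) : quot := \pi_({eq_quot idealrel}) x.
Definition qrepr (q : quot) : A := repr q.

Lemma qreprK q : qpi (qrepr q) = q.
Proof. exact: reprK. Qed.

Lemma qpiP x y : qpi x = qpi y <-> J (x - y).
Proof.
split.
  by move=> /eqmodP /asboolP.
by move=> Jxy; apply/eqmodP/asboolP.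
Qed.

Lemma qreprP x : J (qrepr (qpi x) - x).
Proof. by apply/qpiP; rewrite qreprK. Qed.

Definition qzero : quot := qpi 0.
Definition qadd (a b : quot) : quot := qpi (qrepr a + qrepr b).
Definition qopp (a : quot) : quot := qpi (- qrepr a).
Definition qscale (k : K) (a : quot) : quot := qpi (k *: qrepr a).
Definition qmul (a b : quot) : quot := qpi (qrepr a ** qrepr b).
Definition qstar (a : quot) : quot := qpi ((qrepr a)^*).

Lemma qaddE x y : qadd (qpi x) (qpi y) = qpi (x + y).
Proof. by apply/qpiP; rewrite opprD addrACA; apply: idealD; apply: qreprP. Qed.

Lemma qoppE x : qopp (qpi x) = qpi (- x).
Proof. by apply/qpiP; rewrite -opprD; apply: idealN; apply: qreprP. Qed.

Lemma qscaleE k x : qscale k (qpi x) = qpi (k *: x).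
Proof. by apply/qpiP; rewrite -scalerBr; apply: idealZ; apply: qreprP. Qed.

Lemma qmulE x y : qmul (qpi x) (qpi y) = qpi (x ** y).
Proof.
apply/qpiP; rewrite -(subrKA (x ** qrepr (qpi y))) -sa_mulBl -sa_mulBr.
by apply: idealD; [apply: idealMr | apply: idealMl]; apply: qreprP.
Qed.

Lemma qstarE x : qstar (qpi x) = qpi (x^*).
Proof. by apply/qpiP; rewrite -sa_starB; apply: ideal_star; apply: qreprP. Qed.

Lemma qpi_ind (P : quot -> Prop) : (forall x, P (qpi x)) -> forall q, P q.
Proof. by move=> Px q; rewrite -(qreprK q). Qed.

Let qaddA : associative qadd.
Proof.
by elim/qpi_ind=> x; elim/qpi_ind=> y; elim/qpi_ind=> z; rewrite !qaddE addrA.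
Qed.

Let qaddC : commutative qadd.
Proof. by elim/qpi_ind=> x; elim/qpi_ind=> y; rewrite !qaddE addrC. Qed.

Let qadd0 : left_id qzero qadd.
Proof. by elim/qpi_ind=> x; rewrite !qaddE add0r. Qed.

Let qaddN : left_inverse qzero qopp qadd.
Proof. by elim/qpi_ind=> x; rewrite qoppE qaddE addNr. Qed.

HB.instance Definition _ := GRing.isZmodule.Build quot qaddA qaddC qadd0 qaddN.

Lemma qpiD x y : qpi (x + y) = qpi x + qpi y.
Proof. by rewrite -qaddE. Qed.

Let qscaleA k l (a : quot) : qscale k (qscale l a) = qscale (k * l) a.
Proof. by elim/qpi_ind: a => x; rewrite !qscaleE scalerA. Qed.

Let qscale1 : left_id 1 qscale.
Proof. by elim/qpi_ind=> x; rewrite qscaleE scale1r. Qed.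

Let qscaleDr : right_distributive qscale +%R.
Proof.
move=> k; elim/qpi_ind=> x; elim/qpi_ind=> y.
by rewrite -qpiD !qscaleE -qpiD scalerDr.
Qed.

Let qscaleDl (a : quot) : {morph qscale^~ a : k l / k + l}.
Proof. by move=> k l; elim/qpi_ind: a => x; rewrite !qscaleE -qpiD scalerDl. Qed.

HB.instance Definition _ :=
  GRing.Zmodule_isLmodule.Build K quot qscaleA qscale1 qscaleDr qscaleDl.

Lemma qpiZ k x : qpi (k *: x) = k *: qpi x.
Proof. by rewrite -qscaleE. Qed.

Let qmulA : associative qmul.
Proof.
by elim/qpi_ind=> x; elim/qpi_ind=> y; elim/qpi_ind=> z; rewrite !qmulE sa_mulA.
Qed.

Let qmulDl a b c : qmul (a + b) c = qmul a c + qmul b c.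
Proof.
elim/qpi_ind: a => x; elim/qpi_ind: b => y; elim/qpi_ind: c => z.
by rewrite -qpiD !qmulE -qpiD sa_mulDl.
Qed.

Let qmulDr a b c : qmul a (b + c) = qmul a b + qmul a c.
Proof.
elim/qpi_ind: a => x; elim/qpi_ind: b => y; elim/qpi_ind: c => z.
by rewrite -qpiD !qmulE -qpiD sa_mulDr.
Qed.

Let qscalel (k : K) a b : qmul (k *: a) b = k *: qmul a b.
Proof.
by elim/qpi_ind: a => x; elim/qpi_ind: b => y; rewrite -qpiZ !qmulE -qpiZ sa_scalel.
Qed.

Let qscaler (k : K) a b : qmul a (k *: b) = k *: qmul a b.
Proof.
by elim/qpi_ind: a => x; elim/qpi_ind: b => y; rewrite -qpiZ !qmulE -qpiZ sa_scaler.
Qed.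

Let qstarK : involutive qstar.
Proof. by elim/qpi_ind=> x; rewrite !qstarE sa_starK. Qed.

Let qstarD : {morph qstar : x y / x + y}.
Proof.
by elim/qpi_ind=> x; elim/qpi_ind=> y; rewrite -qpiD !qstarE -qpiD sa_starD.
Qed.

Let qstarZ (k : K) a : qstar (k *: a) = conj k *: qstar a.
Proof. by elim/qpi_ind: a => x; rewrite -qpiZ !qstarE -qpiZ sa_starZ. Qed.

Let qstarM a b : qstar (qmul a b) = qmul (qstar b) (qstar a).
Proof.
by elim/qpi_ind: a => x; elim/qpi_ind: b => y; rewrite !(qstarE, qmulE) sa_starM.
Qed.

HB.instance Definition _ := isStarAlg.Build K conj quot
  qmulA qmulDl qmulDr qscalel qscaler qstarK qstarD qstarZ qstarM.

Lemma qpi_hom : star_hom qpi.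
Proof.
split; first by move=> k x y; rewrite qpiD qpiZ.
- by move=> x y; apply/esym/qmulE.
- by move=> x; apply/esym/qstarE.
Qed.

Lemma quot_lift (B : starAlgType conj) (f : A -> B) :
  star_hom f -> (forall x, J x -> f x = 0) ->
  exists2 g : quot -> B, star_hom g & forall x, g (qpi x) = f x.
Proof.
move=> [fL fM fS] fJ; have fB x y : f (x - y) = f x - f y.
  by rewrite addrC -scaleN1r fL scaleN1r addrC.
have gE x : f (qrepr (qpi x)) = f x.
  by apply/eqP; rewrite -subr_eq0 -fB; apply/eqP/fJ/qreprP.
have [piL piM piS] := qpi_hom.
exists (f \o qrepr) => //; split.
- move=> k; elim/qpi_ind=> x; elim/qpi_ind=> y.
  by rewrite -piL /= !gE fL.
- by elim/qpi_ind=> x; elim/qpi_ind=> y; rewrite -piM /= !gE fM.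
- by elim/qpi_ind=> x; rewrite -piS /= !gE fS.
Qed.

End Quotient.

Section IdealGenerated.
Variables (K : fieldType) (conj : involutive_rmorphism K) (A : starAlgType conj).

Inductive ideal_gen (S : set A) : set A :=
| ig_in x of S x : ideal_gen S x
| ig_0 : ideal_gen S 0
| ig_D x y of ideal_gen S x & ideal_gen S y : ideal_gen S (x + y)
| ig_Z (k : K) x of ideal_gen S x : ideal_gen S (k *: x)
| ig_Ml a x of ideal_gen S x : ideal_gen S (a ** x)
| ig_Mr x a of ideal_gen S x : ideal_gen S (x ** a).

Lemma ideal_gen_star (S : set A) :
  (forall x, S x -> ideal_gen S (x^*)) ->
  forall x, ideal_gen S x -> ideal_gen S (x^*).
Proof.
move=> SS x; elim=> {x} [x /SS //||x y _ Sx _ Sy|k x _ Sx|a x _ Sx|x a _ Sx].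
- by rewrite sa_star0; apply: ig_0.
- by rewrite sa_starD; apply: ig_D.
- by rewrite sa_starZ; apply: ig_Z.
- by rewrite sa_starM; apply: ig_Mr.
- by rewrite sa_starM; apply: ig_Ml.
Qed.

Definition ideal_of (S : set A) (SS : forall x, S x -> ideal_gen S (x^*)) :
    starIdeal A :=
  StarIdeal (ig_0 S) (@ig_D S) (@ig_Z S) (@ig_Ml S) (@ig_Mr S) (ideal_gen_star SS).

End IdealGenerated.

Inductive term (K : Type) (X : Type) :=
| TGen of X
| TZero
| TAdd of term K X & term K X
| TScale of K & term K X
| TMul of term K X & term K X
| TStar of term K X.
Arguments TZero {K X}.
Arguments TGen {K X}.

HB.instance Definition _ K X := gen_eqMixin (term K X).
HB.instance Definition _ K X := gen_choiceMixin (term K X).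

Section Free.
Variables (K : fieldType) (conj : involutive_rmorphism K) (X : Type).
Local Notation term := (term K X).

(* Equality of terms modulo the axioms of star-algebras. *)
Inductive teq : term -> term -> Prop :=
| teq_refl t : teq t t
| teq_sym t u of teq t u : teq u t
| teq_trans t u v of teq t u & teq u v : teq t v
| teq_cadd t t' u u' of teq t t' & teq u u' : teq (TAdd t u) (TAdd t' u')
| teq_cscale k t t' of teq t t' : teq (TScale k t) (TScale k t')
| teq_cmul t t' u u' of teq t t' & teq u u' : teq (TMul t u) (TMul t' u')
| teq_cstar t t' of teq t t' : teq (TStar t) (TStar t')
| teq_addA t u v : teq (TAdd t (TAdd u v)) (TAdd (TAdd t u) v)
| teq_addC t u : teq (TAdd t u) (TAdd u t)
| teq_add0 t : teq (TAdd TZero t) t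
| teq_addN t : teq (TAdd (TScale (-1) t) t) TZero
| teq_scaleA k l t : teq (TScale k (TScale l t)) (TScale (k * l) t)
| teq_scale1 t : teq (TScale 1 t) t
| teq_scaleDr k t u : teq (TScale k (TAdd t u)) (TAdd (TScale k t) (TScale k u))
| teq_scaleDl k l t : teq (TScale (k + l) t) (TAdd (TScale k t) (TScale l t))
| teq_mulA t u v : teq (TMul t (TMul u v)) (TMul (TMul t u) v)
| teq_mulDl t u v : teq (TMul (TAdd t u) v) (TAdd (TMul t v) (TMul u v))
| teq_mulDr t u v : teq (TMul t (TAdd u v)) (TAdd (TMul t u) (TMul t v))
| teq_scalel k t u : teq (TMul (TScale k t) u) (TScale k (TMul t u))
| teq_scaler k t u : teq (TMul t (TScale k u)) (TScale k (TMul t u))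
| teq_starK t : teq (TStar (TStar t)) t
| teq_starD t u : teq (TStar (TAdd t u)) (TAdd (TStar t) (TStar u))
| teq_starZ k t : teq (TStar (TScale k t)) (TScale (conj k) (TStar t))
| teq_starM t u : teq (TStar (TMul t u)) (TMul (TStar u) (TStar t)).

Definition teqb : rel term := fun t u => `[< teq t u >].

Lemma teqb_refl : reflexive teqb.
Proof. by move=> t; apply/asboolP/teq_refl. Qed.

Lemma teqb_sym : symmetric teqb.
Proof. by move=> t u; apply/asboolP/asboolP; apply: teq_sym. Qed.

Lemma teqb_trans : transitive teqb.
Proof.
by move=> u t v /asboolP tu /asboolP uv; apply/asboolP; apply: teq_trans uv.
Qed.

Canonical teqb_equiv := EquivRel teqb teqb_refl teqb_sym teqb_trans.

Definition free := {eq_quot teqb}.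

HB.instance Definition _ := Choice.on free.

Definition fpi (t : term) : free := \pi_({eq_quot teqb}) t.
Definition frepr (a : free) : term := repr a.

Lemma freprK a : fpi (frepr a) = a.
Proof. exact: reprK. Qed.

Lemma fpiP t u : fpi t = fpi u <-> teq t u.
Proof. by split=> [/eqmodP /asboolP|tu] //; apply/eqmodP/asboolP. Qed.

Lemma freprP t : teq (frepr (fpi t)) t.
Proof. by apply/fpiP; rewrite freprK. Qed.

Lemma fpi_ind (P : free -> Prop) : (forall t, P (fpi t)) -> forall a, P a.
Proof. by move=> Pt a; rewrite -(freprK a). Qed.

Definition fgen (x : X) : free := fpi (TGen x).
Definition fzero : free := fpi TZero.
Definition fadd (a b : free) : free := fpi (TAdd (frepr a) (frepr b)).
Definition fscale (k : K) (a : free) : free := fpi (TScale k (frepr a)).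
Definition fopp (a : free) : free := fscale (-1) a.
Definition fmul (a b : free) : free := fpi (TMul (frepr a) (frepr b)).
Definition fstar (a : free) : free := fpi (TStar (frepr a)).

Lemma faddE t u : fadd (fpi t) (fpi u) = fpi (TAdd t u).
Proof. by apply/fpiP; apply: teq_cadd; apply: freprP. Qed.

Lemma fscaleE k t : fscale k (fpi t) = fpi (TScale k t).
Proof. by apply/fpiP; apply: teq_cscale; apply: freprP. Qed.

Lemma fmulE t u : fmul (fpi t) (fpi u) = fpi (TMul t u).
Proof. by apply/fpiP; apply: teq_cmul; apply: freprP. Qed.

Lemma fstarE t : fstar (fpi t) = fpi (TStar t).
Proof. by apply/fpiP; apply: teq_cstar; apply: freprP. Qed.

Let faddA : associative fadd.
Proof.
elim/fpi_ind=> t; elim/fpi_ind=> u; elim/fpi_ind=> v.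
by rewrite !faddE; apply/fpiP/teq_addA.
Qed.

Let faddC : commutative fadd.
Proof.
by elim/fpi_ind=> t; elim/fpi_ind=> u; rewrite !faddE; apply/fpiP/teq_addC.
Qed.

Let fadd0 : left_id fzero fadd.
Proof. by elim/fpi_ind=> t; rewrite faddE; apply/fpiP/teq_add0. Qed.

Let faddN : left_inverse fzero fopp fadd.
Proof.
by elim/fpi_ind=> t; rewrite /fopp fscaleE faddE; apply/fpiP/teq_addN.
Qed.

HB.instance Definition _ := GRing.isZmodule.Build free faddA faddC fadd0 faddN.

Let fpiD t u : fpi (TAdd t u) = fpi t + fpi u.
Proof. by rewrite -faddE. Qed.

Let fscaleA k l (a : free) : fscale k (fscale l a) = fscale (k * l) a.
Proof. by elim/fpi_ind: a => t; rewrite !fscaleE; apply/fpiP/teq_scaleA. Qed.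

Let fscale1 : left_id 1 fscale.
Proof. by elim/fpi_ind=> t; rewrite fscaleE; apply/fpiP/teq_scale1. Qed.

Let fscaleDr : right_distributive fscale +%R.
Proof.
move=> k; elim/fpi_ind=> t; elim/fpi_ind=> u.
by rewrite -fpiD !fscaleE -fpiD; apply/fpiP/teq_scaleDr.
Qed.

Let fscaleDl (a : free) : {morph fscale^~ a : k l / k + l}.
Proof.
by move=> k l; elim/fpi_ind: a => t; rewrite !fscaleE -fpiD; apply/fpiP/teq_scaleDl.
Qed.

HB.instance Definition _ :=
  GRing.Zmodule_isLmodule.Build K free fscaleA fscale1 fscaleDr fscaleDl.

Let fpiZ k t : fpi (TScale k t) = k *: fpi t.
Proof. by rewrite -fscaleE. Qed.

Let fmulA : associative fmul.
Proof.
elim/fpi_ind=> t; elim/fpi_ind=> u; elim/fpi_ind=> v.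
by rewrite !fmulE; apply/fpiP/teq_mulA.
Qed.

Let fmulDl a b c : fmul (a + b) c = fmul a c + fmul b c.
Proof.
elim/fpi_ind: a => t; elim/fpi_ind: b => u; elim/fpi_ind: c => v.
by rewrite -fpiD !fmulE -fpiD; apply/fpiP/teq_mulDl.
Qed.

Let fmulDr a b c : fmul a (b + c) = fmul a b + fmul a c.
Proof.
elim/fpi_ind: a => t; elim/fpi_ind: b => u; elim/fpi_ind: c => v.
by rewrite -fpiD !fmulE -fpiD; apply/fpiP/teq_mulDr.
Qed.

Let fscalel (k : K) a b : fmul (k *: a) b = k *: fmul a b.
Proof.
elim/fpi_ind: a => t; elim/fpi_ind: b => u.
by rewrite -fpiZ !fmulE -fpiZ; apply/fpiP/teq_scalel.
Qed.

Let fscaler (k : K) a b : fmul a (k *: b) = k *: fmul a b.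
Proof.
elim/fpi_ind: a => t; elim/fpi_ind: b => u.
by rewrite -fpiZ !fmulE -fpiZ; apply/fpiP/teq_scaler.
Qed.

Let fstarK : involutive fstar.
Proof. by elim/fpi_ind=> t; rewrite !fstarE; apply/fpiP/teq_starK. Qed.

Let fstarD : {morph fstar : x y / x + y}.
Proof.
elim/fpi_ind=> t; elim/fpi_ind=> u.
by rewrite -fpiD !fstarE -fpiD; apply/fpiP/teq_starD.
Qed.

Let fstarZ (k : K) a : fstar (k *: a) = conj k *: fstar a.
Proof.
by elim/fpi_ind: a => t; rewrite -fpiZ !fstarE -fpiZ; apply/fpiP/teq_starZ.
Qed.

Let fstarM a b : fstar (fmul a b) = fmul (fstar b) (fstar a).
Proof.
elim/fpi_ind: a => t; elim/fpi_ind: b => u.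
by rewrite !(fstarE, fmulE); apply/fpiP/teq_starM.
Qed.

HB.instance Definition _ := isStarAlg.Build K conj free
  fmulA fmulDl fmulDr fscalel fscaler fstarK fstarD fstarZ fstarM.

Let fpiM t u : fpi (TMul t u) = fpi t ** fpi u.
Proof. exact/esym/fmulE. Qed.

Let fpiS t : fpi (TStar t) = (fpi t)^*.
Proof. exact/esym/fstarE. Qed.

Lemma free_ind (P : free -> Prop) :
  (forall x, P (fgen x)) -> P 0 ->
  (forall a b, P a -> P b -> P (a + b)) -> (forall k a, P a -> P (k *: a)) ->
  (forall a b, P a -> P b -> P (a ** b)) -> (forall a, P a -> P (a^*)) ->
  forall a, P a.
Proof.
move=> Pg P0 PD PZ PM PS; elim/fpi_ind; elim=> [x||t Pt u Pu|k t Pt|t Pt u Pu|t Pt].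
- exact: Pg.
- exact: P0.
- by rewrite fpiD; apply: PD.
- by rewrite fpiZ; apply: PZ.
- by rewrite fpiM; apply: PM.
- by rewrite fpiS; apply: PS.
Qed.

Lemma free_lift (B : starAlgType conj) (f : X -> B) :
  exists2 g : free -> B, star_hom g & forall x, g (fgen x) = f x.
Proof.
pose fix ev (t : term) : B := match t with
  | TGen x => f x | TZero => 0 | TAdd t u => ev t + ev u
  | TScale k t => k *: ev t | TMul t u => ev t ** ev u | TStar t => (ev t)^* end.
have evP t u : teq t u -> ev t = ev u.
  elim=> //= {t u}; try by move=> *; congruence.
  - by move=> *; rewrite addrA.
  - by move=> *; rewrite addrC.
  - by move=> *; rewrite add0r.
  - by move=> *; rewrite scaleN1r addNr.
  - by move=> *; rewrite scalerA.
  - by move=> *; rewrite scale1r.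
  - by move=> *; rewrite scalerDr.
  - by move=> *; rewrite scalerDl.
  - by move=> *; rewrite sa_mulA.
  - by move=> *; rewrite sa_mulDl.
  - by move=> *; rewrite sa_mulDr.
  - by move=> *; rewrite sa_scalel.
  - by move=> *; rewrite sa_scaler.
  - by move=> *; rewrite sa_starK.
  - by move=> *; rewrite sa_starD.
  - by move=> *; rewrite sa_starZ.
  - by move=> *; rewrite sa_starM.
have gE t : ev (frepr (fpi t)) = ev t by apply/evP/freprP.
exists (ev \o frepr) => [|x]; last exact: gE.
split.
- move=> k; elim/fpi_ind=> t; elim/fpi_ind=> u.
  by rewrite -fpiZ -fpiD /= !gE.
- by elim/fpi_ind=> t; elim/fpi_ind=> u; rewrite -fpiM /= !gE.
- by elim/fpi_ind=> t; rewrite -fpiS /= !gE.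
Qed.

End Free.
Arguments fgen {K} conj {X}.

Section Presentation.
Variables (K : fieldType) (conj : involutive_rmorphism K) (X : Type).
Variable R : free conj X -> free conj X -> Prop.

(* Adjoints are included because the quotient is taken in the category of
   star-algebras. *)
Definition relators : set (free conj X) :=
  [set z | exists a b, R a b /\ (z = a - b \/ z = (a - b)^*)].

Lemma relators_star z : relators z -> ideal_gen relators (z^*).
Proof.
move=> [a [b [Rab [->|->]]]]; apply: ig_in; exists a, b; split=> //.
- by right.
- by left; rewrite sa_starK.
Qed.

Definition pres : starAlgType conj := quot (ideal_of relators_star).
Definition pgen (x : X) : pres := qpi (ideal_of relators_star) (fgen conj x).

Lemma pres_rel a b :
  R a b -> qpi (ideal_of relators_star) a = qpi (ideal_of relators_star) b.
Proof. by move=> Rab; apply/qpiP/ig_in; exists a, b; split=> //; left. Qed.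

Lemma pres_ind (P : pres -> Prop) :
  (forall x, P (pgen x)) -> P 0 ->
  (forall a b, P a -> P b -> P (a + b)) -> (forall k a, P a -> P (k *: a)) ->
  (forall a b, P a -> P b -> P (a ** b)) -> (forall a, P a -> P (a^*)) ->
  forall a, P a.
Proof.
have [_ piM piS] := qpi_hom (ideal_of relators_star).
move=> Pg P0 PD PZ PM PS; elim/qpi_ind; elim/free_ind=> //.
- by move=> a b Pa Pb; rewrite qpiD; apply: PD.
- by move=> k a Pa; rewrite qpiZ; apply: PZ.
- by move=> a b Pa Pb; rewrite piM; apply: PM.
- by move=> a Pa; rewrite piS; apply: PS.
Qed.

Lemma pres_lift (B : starAlgType conj) (f : free conj X -> B) :
  star_hom f -> (forall a b, R a b -> f a = f b) ->
  exists2 g : pres -> B, star_hom g & forall x, g (pgen x) = f (fgen conj x).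
Proof.
move=> fH fR; have [fL fM fS] := fH.
have f0 : f 0 = 0 by have := fL (-1) 0 0; rewrite !scaleN1r oppr0 addr0 addNr.
have fB x y : f (x - y) = f x - f y.
  by rewrite addrC -scaleN1r fL scaleN1r addrC.
have fD x y : f (x + y) = f x + f y by have := fL 1 x y; rewrite !scale1r.
have fZ k x : f (k *: x) = k *: f x by have := fL k x 0; rewrite f0 !addr0.
have [x /= Jx|g gH gE] := quot_lift (J := ideal_of relators_star) fH.
  elim: {x} Jx => [x [a [b [Rab xE]]]||x y _ fx _ fy|k x _ fx|a x _ fx|x a _ fx].
  - by case: xE => ->; rewrite ?fS fB (fR _ _ Rab) subrr // sa_star0.
  - exact: f0.
  - by rewrite fD fx fy addr0.
  - by rewrite fZ fx scaler0.
  - by rewrite fM fx sa_mul0r.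
  - by rewrite fM fx sa_mul0l.
by exists g => // x; apply: gE.
Qed.

End Presentation.

(* Meant for a set F of partial isometries that generates A. *)
Section Tame.
Variables (K : fieldType) (conj : involutive_rmorphism K) (A : starAlgType conj).
Variable F : set A.

Inductive star_semigroup : set A :=
| ss_in u of F u : star_semigroup u
| ss_mul u v of star_semigroup u & star_semigroup v : star_semigroup (u ** v)
| ss_star u of star_semigroup u : star_semigroup (u^*).

Definition eproj (u : A) : A := u ** u^*.

Definition tame_commutators : set A :=
  [set c | exists u u', [/\ star_semigroup u, star_semigroup u' &
             c = eproj u ** eproj u' - eproj u' ** eproj u]].

Lemma tame_commutators_star c :
  tame_commutators c -> ideal_gen tame_commutators (c^*).
Proof.
move=> [u [u' [Uu Uu' ->]]]; apply: ig_in; exists u', u; split=> //.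
by rewrite sa_starB /eproj !sa_starM !sa_starK.
Qed.

Definition tame_ideal : starIdeal A := ideal_of tame_commutators_star.

Definition tame_alg : starAlgType conj := quot tame_ideal.
Definition tame_pi : A -> tame_alg := qpi tame_ideal.

End Tame.

Record starSub (K : fieldType) (conj : involutive_rmorphism K)
    (A : starAlgType conj) := StarSub {
  sub_set :> A -> Prop;
  sub0 : sub_set 0;
  subD : forall x y, sub_set x -> sub_set y -> sub_set (x + y);
  subZ : forall (k : K) x, sub_set x -> sub_set (k *: x);
  subM : forall x y, sub_set x -> sub_set y -> sub_set (x ** y);
  subS : forall x, sub_set x -> sub_set (x^*)
}.

Section SubAlgebra.
Variables (K : fieldType) (conj : involutive_rmorphism K).
Variables (A : starAlgType conj) (S : starSub A).

Definition sub_pred : pred A := fun x => `[< S x >].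

Record subalg := SubAlg { subval :> A; subvalP : sub_pred subval }.

HB.instance Definition _ := [isSub for subval].
HB.instance Definition _ := [Choice of subalg by <:].

Lemma sub_closed : submod_closed sub_pred.
Proof.
split; first exact/asboolP/sub0.
move=> k x y /asboolP Sx /asboolP Sy; apply/asboolP.
by apply: subD => //; apply: subZ.
Qed.

HB.instance Definition _ :=
  GRing.SubChoice_isSubLmodule.Build K A sub_pred subalg sub_closed.

Lemma sub_mulP (x y : subalg) : sub_pred (subval x ** subval y).
Proof.
by apply/asboolP; apply: subM; apply/asboolP; apply: subvalP.
Qed.

Lemma sub_starP (x : subalg) : sub_pred ((subval x)^*).
Proof. by apply/asboolP; apply: subS; apply/asboolP; apply: subvalP. Qed.

Definition sub_mul (x y : subalg) : subalg := SubAlg (sub_mulP x y).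
Definition sub_star (x : subalg) : subalg := SubAlg (sub_starP x).

Let smA : associative sub_mul.
Proof. by move=> x y z; apply/val_inj/sa_mulA. Qed.
Let smDl x y z : sub_mul (x + y) z = sub_mul x z + sub_mul y z.
Proof. exact/val_inj/sa_mulDl. Qed.
Let smDr x y z : sub_mul x (y + z) = sub_mul x y + sub_mul x z.
Proof. exact/val_inj/sa_mulDr. Qed.
Let smZl (k : K) x y : sub_mul (k *: x) y = k *: sub_mul x y.
Proof. exact/val_inj/sa_scalel. Qed.
Let smZr (k : K) x y : sub_mul x (k *: y) = k *: sub_mul x y.
Proof. exact/val_inj/sa_scaler. Qed.
Let ssK : involutive sub_star.
Proof. by move=> x; apply/val_inj/sa_starK. Qed.
Let ssD : {morph sub_star : x y / x + y}.
Proof. by move=> x y; apply/val_inj/sa_starD. Qed.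
Let ssZ (k : K) x : sub_star (k *: x) = conj k *: sub_star x.
Proof. exact/val_inj/sa_starZ. Qed.
Let ssM x y : sub_star (sub_mul x y) = sub_mul (sub_star y) (sub_star x).
Proof. exact/val_inj/sa_starM. Qed.

HB.instance Definition _ := isStarAlg.Build K conj subalg
  smA smDl smDr smZl smZr ssK ssD ssZ ssM.

Lemma subval_hom : star_hom subval.
Proof. by []. Qed.

End SubAlgebra.

Section Corner.
Variables (K : fieldType) (conj : involutive_rmorphism K) (A : starAlgType conj).

Inductive lspan (S : set A) : set A :=
| lspan_in x of S x : lspan S x
| lspan_0 : lspan S 0
| lspan_D x y of lspan S x & lspan S y : lspan S (x + y)
| lspan_Z (k : K) x of lspan S x : lspan S (k *: x).

Variables (I : Type) (p : I -> A).
Hypothesis p_star : forall i, (p i)^* = p i.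

Definition corner_set : set A :=
  lspan [set z | exists i j x, z = p i ** x ** p j].

Lemma corner_mul x y : corner_set x -> corner_set y -> corner_set (x ** y).
Proof.
move=> Cx; elim=> {y} [_ [i [j [y ->]]]||y z _ Cy _ Cz|k y _ Cy].
- elim: Cx => {x} [_ [i' [j' [x ->]]]||x z _ Cx _ Cz|k x _ Cx].
  + apply: lspan_in; exists i', j, (x ** p j' ** p i ** y).
    by rewrite !sa_mulA.
  + by rewrite sa_mul0l; apply: lspan_0.
  + by rewrite sa_mulDl; apply: lspan_D.
  + by rewrite sa_scalel; apply: lspan_Z.
- by rewrite sa_mul0r; apply: lspan_0.
- by rewrite sa_mulDr; apply: lspan_D.
- by rewrite sa_scaler; apply: lspan_Z.
Qed.

Lemma corner_star x : corner_set x -> corner_set (x^*).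
Proof.
elim=> {x} [_ [i [j [x ->]]]||x y _ Cx _ Cy|k x _ Cx].
- apply: lspan_in; exists j, i, (x^*).
  by rewrite !sa_starM !p_star sa_mulA.
- by rewrite sa_star0; apply: lspan_0.
- by rewrite sa_starD; apply: lspan_D.
- by rewrite sa_starZ; apply: lspan_Z.
Qed.

Definition corner_sub : starSub A :=
  StarSub (@lspan_0 _) (@lspan_D _) (@lspan_Z _) corner_mul corner_star.

Definition corner : starAlgType conj := subalg corner_sub.

End Corner.

Record digraph := Digraph {
  vertex : choiceType;
  edge : choiceType;
  src : edge -> vertex;
  tgt : edge -> vertex
}.
Arguments src {d}.
Arguments tgt {d}.

Definition out_edges (E : digraph) (v : vertex E) : set (edge E) :=
  [set e | src e = v].
Definition in_edges (E : digraph) (v : vertex E) : set (edge E) :=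
  [set e | tgt e = v].

Definition row_finite (E : digraph) : Prop :=
  forall v : vertex E, finite_set (out_edges v).

Definition locally_finite (E : digraph) : Prop :=
  forall v : vertex E, finite_set (out_edges v) /\ finite_set (in_edges v).

Record weighted_graph := WeightedGraph {
  wgraph :> digraph;
  weight : edge wgraph -> nat;
  weight_gt0 : forall e, (0 < weight e)%N;
  wgraph_row_finite : row_finite wgraph;
  wgraph_no_isolated :
    forall v : vertex wgraph, ~ (out_edges v = set0 /\ in_edges v = set0)
}.
Arguments weight {w}.

(* The maximum over the empty set is 0, as required for sinks. *)
Definition vweight (E : weighted_graph) (v : vertex E) : nat :=
  \big[maxn/0%N]_(e \in out_edges v) weight e.

Section LeavittWeighted.
Variables (K : fieldType) (conj : involutive_rmorphism K) (E : weighted_graph).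

(* The indices i of the e_i range over 'I_(weight e) = {0, ..., weight e - 1},
   i.e., they are shifted by one. *)
Inductive L1_gen := L1v of vertex E | L1e (e : edge E) of 'I_(weight e).

(* The set of pairs (e, i); [Tagged _ i] is the pair (e, i). *)
Definition wedge := {e : edge E & 'I_(weight e)}.

Local Notation "[ 'v' v ]" := (fgen conj (L1v v)) (format "[ 'v'  v ]").
Local Notation "[ 'e' i ]" := (fgen conj (L1e i)) (format "[ 'e'  i ]").

Inductive L1_rel : free conj L1_gen -> free conj L1_gen -> Prop :=
| L1_vv u v : L1_rel ([v u] ** [v v]) ((u == v)%:R *: [v u])
| L1_vstar v : L1_rel [v v] ([v v]^*)
| L1_src e (i : 'I_(weight e)) : L1_rel ([v src e] ** [e i]) [e i]
| L1_tgt e (i : 'I_(weight e)) : L1_rel ([e i] ** [v tgt e]) [e i]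
| L1_ee e (i j : 'I_(weight e)) of i <> j : L1_rel ([e i] ** [e j]^*) 0
| L1_ef e f (i : 'I_(weight e)) (j : 'I_(weight f))
    of src e = src f & e <> f & i = j :> nat : L1_rel ([e i]^* ** [e j]) 0
| L1_out v k of out_edges v !=set0 & (k < vweight v)%N :
    L1_rel
      (\sum_(g \in [set g : wedge | src (tag g) = v /\ tagged g = k :> nat])
         [e tagged g] ** [e tagged g]^*)
      [v v]
| L1_in e : L1_rel (\sum_(i < weight e) [e i]^* ** [e i]) [v tgt e].

Definition L1 : starAlgType conj := pres L1_rel.

Definition Lab : starAlgType conj := tame_alg (range (pgen L1_rel)).

Definition Lab_vertex (v : vertex E) : Lab :=
  tame_pi (range (pgen L1_rel)) (pgen L1_rel (L1v v)).
Definition Lab_edge (e : edge E) (i : 'I_(weight e)) : Lab :=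
  tame_pi (range (pgen L1_rel)) (pgen L1_rel (L1e i)).

End LeavittWeighted.

Record sepgraph := SepGraph {
  sgraph :> digraph;
  sep : vertex sgraph -> set (set (edge sgraph));
  sepP : forall v, partition (sep v) id (out_edges v)
}.
Arguments sep {s}.

Section LeavittSeparated.
Variables (K : fieldType) (conj : involutive_rmorphism K) (F : sepgraph).

Inductive LS_gen := LSv of vertex F | LSe of edge F.

Local Notation "[ 'v' v ]" := (fgen conj (LSv v)) (format "[ 'v'  v ]").
Local Notation "[ 'e' e ]" := (fgen conj (LSe e)) (format "[ 'e'  e ]").

Inductive LS_rel : free conj LS_gen -> free conj LS_gen -> Prop :=
| LS_vv v v' : LS_rel ([v v] ** [v v']) ((v == v')%:R *: [v v])
| LS_vstar v : LS_rel [v v] ([v v]^*)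
| LS_src e : LS_rel ([v src e] ** [e e]) [e e]
| LS_tgt e : LS_rel ([e e] ** [v tgt e]) [e e]
| LS_ef v (X : set (edge F)) e f of sep v X & X e & X f :
    LS_rel ([e e]^* ** [e f]) ((e == f)%:R *: [v tgt e])
| LS_sum v (X : set (edge F)) of sep v X & finite_set X :
    LS_rel [v v] (\sum_(e \in X) [e e] ** [e e]^*).

Definition LS : starAlgType conj := pres LS_rel.

Definition LSab : starAlgType conj := tame_alg (range (pgen LS_rel)).
Definition pi_infty : LS -> LSab := tame_pi (range (pgen LS_rel)).

Definition LSab_vertex (v : vertex F) : LSab := pi_infty (pgen LS_rel (LSv v)).
Definition LSab_edge (e : edge F) : LSab := pi_infty (pgen LS_rel (LSe e)).

Lemma LSab_vertex_star v : (LSab_vertex v)^* = LSab_vertex v.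
Proof.
rewrite /LSab_vertex /pi_infty /tame_pi; set J := tame_ideal _.
have [_ _ piS] := qpi_hom J; rewrite -piS; congr (qpi J _).
have [_ _ piS'] := qpi_hom (ideal_of (@relators_star _ _ _ LS_rel)).
by rewrite /pgen -piS'; apply/esym/pres_rel/LS_vstar.
Qed.

End LeavittSeparated.

(* The vertex set is the disjoint union of [bvertex0] and [bvertex1]. *)
Record bisepgraph := BisepGraph {
  bvertex0 : choiceType;
  bvertex1 : choiceType;
  bedge : choiceType;
  bsrc : bedge -> bvertex0;
  btgt : bedge -> bvertex1;
  bsep : bvertex0 -> set (set bedge);
  bsepP : forall v, partition (bsep v) id [set e | bsrc e = v]
}.
Arguments bsrc {b}.
Arguments btgt {b}.
Arguments bsep {b}.

Section BipartiteSepGraph.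
Variable F : bisepgraph.

Definition bidigraph : digraph :=
  @Digraph (bvertex0 F + bvertex1 F)%type (bedge F)
    (fun e => inl (bsrc e)) (fun e => inr (btgt e)).

Definition bidigraph_sep (v : vertex bidigraph) : set (set (edge bidigraph)) :=
  match v with inl v0 => bsep v0 | inr _ => set0 end.

Lemma bidigraph_sepP v : partition (bidigraph_sep v) id (out_edges v).
Proof.
case: v => [v|w] /=.
  have [cv tv nv] := bsepP v; split=> //; rewrite cv.
  by apply/seteqP; split=> e /=; [move=> <- | case].
by split=> //; apply/seteqP; split=> e //= [].
Qed.

Definition bisep_sepgraph : sepgraph := SepGraph bidigraph_sepP.

End BipartiteSepGraph.

Coercion bisep_sepgraph : bisepgraph >-> sepgraph.

Section LV.
Variables (K : fieldType) (conj : involutive_rmorphism K) (F : bisepgraph).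

Inductive LV_gen :=
| LVp of bvertex0 F
| LVtau (e f : bedge F) of btgt e = btgt f.

Local Notation "[ 'p' v ]" := (fgen conj (LVp v)) (format "[ 'p'  v ]").
Local Notation "[ 'tau' h ]" := (fgen conj (LVtau h)) (format "[ 'tau'  h ]").

(* [LV_tau_mul] and [LV_tau_mul0] are the cases f = g and f <> g of the relation
   tau(e,f) tau(g,h) = delta_{f,g} tau(e,h); tau(e,h) only makes sense in the
   first case. *)
Inductive LV_rel : free conj LV_gen -> free conj LV_gen -> Prop :=
| LV_pp v v' : LV_rel ([p v] ** [p v']) ((v == v')%:R *: [p v])
| LV_pstar v : LV_rel ([p v]^*) [p v]
| LV_taustar e f (ef : btgt e = btgt f) (fe : btgt f = btgt e) :
    LV_rel ([tau ef]^*) [tau fe]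
| LV_taup e f (ef : btgt e = btgt f) :
    LV_rel ([tau ef] ** [p bsrc f]) [tau ef]
| LV_ptau e f (ef : btgt e = btgt f) :
    LV_rel ([p bsrc e] ** [tau ef]) [tau ef]
| LV_tau_mul v (Y : set (bedge F)) e f h (ef : btgt e = btgt f)
    (fh : btgt f = btgt h) (eh : btgt e = btgt h) of bsep v Y & Y f :
    LV_rel ([tau ef] ** [tau fh]) [tau eh]
| LV_tau_mul0 v (Y : set (bedge F)) e f g h (ef : btgt e = btgt f)
    (gh : btgt g = btgt h) of bsep v Y & Y f & Y g & f <> g :
    LV_rel ([tau ef] ** [tau gh]) 0
| LV_sum v (Y : set (bedge F)) of bsep v Y :
    LV_rel [p v] (\sum_(e \in Y) [tau (erefl (btgt e))]).

Definition LV : starAlgType conj := pres LV_rel.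

Definition LVab : starAlgType conj := tame_alg (range (pgen LV_rel)).

Definition LVab_p (v : bvertex0 F) : LVab :=
  tame_pi (range (pgen LV_rel)) (pgen LV_rel (LVp v)).
Definition LVab_tau (e f : bedge F) (ef : btgt e = btgt f) : LVab :=
  tame_pi (range (pgen LV_rel)) (pgen LV_rel (LVtau ef)).

(* The corner of [LSab] cut by the multiplier which is the sum of the images of
   the vertices in [bvertex0]. *)
Definition Vcorner : starAlgType conj :=
  corner (p := fun v : bvertex0 F => LSab_vertex conj (F := F) (inl v))
    (fun v => LSab_vertex_star conj (F := F) (inl v)).

End LV.

Section WeightedToSeparated.
Variable E : weighted_graph.

Definition E1_vertex1 : choiceType := wedge E.

(* E1 is the bipartite separated graph (E(omega)_1, C(omega)^1): the second part
   of the vertices is {v(e, i)}, identified with the set of pairs (e, i), and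
   [inl (e, i)] is the edge alpha^i(e) and [inr (e, i)] is the edge alpha^e(i). *)
Definition E1_edge : choiceType := (wedge E + wedge E)%type.

Definition alpha_up (e : edge E) (i : 'I_(weight e)) : E1_edge :=
  inl (Tagged (fun e => 'I_(weight e)) i).
Definition alpha_dn (e : edge E) (i : 'I_(weight e)) : E1_edge :=
  inr (Tagged (fun e => 'I_(weight e)) i).

Definition E1_src (a : E1_edge) : vertex E :=
  match a with inl g => src (tag g) | inr g => tgt (tag g) end.
Definition E1_tgt (a : E1_edge) : E1_vertex1 :=
  match a with inl g => g | inr g => g end.

Definition E1_Xv (v : vertex E) (k : nat) : set E1_edge :=
  [set a | exists (e : edge E) (i : 'I_(weight e)),
     [/\ src e = v, i = k :> nat & a = alpha_up i]].
Definition E1_Xe (e : edge E) : set E1_edge :=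
  [set a | exists i : 'I_(weight e), a = alpha_dn i].

Definition E1_sep (v : vertex E) : set (set E1_edge) :=
  [set X | (exists2 k, (k < vweight v)%N & X = E1_Xv v k) \/
           (exists2 e, tgt e = v & X = E1_Xe e)].

Lemma weight_le_vweight (e : edge E) : (weight e <= vweight (src e))%N.
Proof.
rewrite /vweight fsbig_finite /=; last exact: wgraph_row_finite.
apply: (bigop.leq_bigmax_seq (F := fun e => weight e)) => //.
by rewrite in_fset_set ?inE //; apply: wgraph_row_finite.
Qed.

Lemma vweight_lt (v : vertex E) k :
  (k < vweight v)%N -> exists2 e : edge E, src e = v & (k < weight e)%N.
Proof.
rewrite /vweight fsbig_finite /=; last exact: wgraph_row_finite.
apply: contraPP => /forall2NP H; apply/negP; rewrite -leqNgt.
apply/bigop.bigmax_leqP_seq => e; rewrite in_fset_set; last exact: wgraph_row_finite.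
rewrite inE => /= ev _; rewrite leqNgt; apply/negP.
by case: (H e).
Qed.

Lemma E1_sepP v : partition (E1_sep v) id [set a | E1_src a = v].
Proof.
split.
- apply/seteqP; split=> [a [X [[k _ ->]|[e ev ->]] /=]|].
  + by move=> [e [i [ev _ ->]]].
  + by move=> [i ->].
  case=> [[e i]|[e i]] /= ev.
  + exists (E1_Xv v i); last by exists e, i.
    by left; exists i => //; rewrite -ev (leq_trans (ltn_ord i)) ?weight_le_vweight.
  + by exists (E1_Xe e); [right; exists e | exists i].
- move=> X Y /= [[k _ ->]|[e ev ->]] [[l _ ->]|[f fv ->]] [a []].
  + move=> [e [i [_ ik ->]]] [f [j [_ jl aE]]].
    have /= ij := congr1 (fun b : E1_edge =>
      match b with inl g => val (tagged g) | inr g => val (tagged g) end) aE.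
    by congr (E1_Xv v _); rewrite -ik -jl.
  + by move=> [e [i [_ _ ->]]] [].
  + by move=> [i ->] [f [j [_ _]]].
  + move=> [i ->] [j aE].
    have /= ef := congr1 (fun b : E1_edge =>
      match b with inl g => tag g | inr g => tag g end) aE.
    by rewrite ef.
- move=> X [[k kv ->]|[e ev ->]].
  + have [e ev ke] := vweight_lt kv.
    by exists (alpha_up (Ordinal ke)), e, (Ordinal ke).
  + by exists (alpha_dn (Ordinal (weight_gt0 e))), (Ordinal (weight_gt0 e)).
Qed.

Definition E1 : bisepgraph :=
  @BisepGraph (vertex E) E1_vertex1 E1_edge E1_src E1_tgt E1_sep E1_sepP.

(* [LV_rel] is meant for row-finite graphs in which every vertex of the first
   (second) part is the source (target) of an edge; this is the case of [E1]. *)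
Lemma E1_row_finite : locally_finite E -> row_finite E1.
Proof.
move=> lfE; have fin (D : set (edge E)) : finite_set D ->
    finite_set [set g : wedge E | D (tag g)].
  move=> finD; apply: (@sub_finite_set _ _ (\bigcup_(e in D)
      [set Tagged (fun e => 'I_(weight e)) i | i in [set: 'I_(weight e)]])).
    by move=> [e i] /= De; exists e => //; exists i.
  apply: bigcup_finite => // e _; apply: finite_image.
  exact: finite_finset.
case=> [v|w]; last by rewrite (_ : out_edges _ = set0) //; apply/seteqP; split=> e.
have [fo fi] := lfE v.
apply: (@sub_finite_set _ _ (inl @` [set g : wedge E | out_edges v (tag g)] `|`
                             inr @` [set g : wedge E | in_edges v (tag g)])).
  by case=> g /= [gv]; [left | right]; exists g.
by rewrite finite_setU; split; apply: finite_image; apply: fin.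
Qed.

Lemma E1_src_surj (v : bvertex0 E1) : exists a : bedge E1, bsrc a = v.
Proof.
apply: contrapT => noa; apply: (wgraph_no_isolated (v := v)).
split; apply/seteqP; split=> e //= ev; apply: noa.
- by exists (alpha_up (Ordinal (weight_gt0 e))).
- by exists (alpha_dn (Ordinal (weight_gt0 e))).
Qed.

Lemma E1_tgt_surj (w : bvertex1 E1) : exists a : bedge E1, btgt a = w.
Proof. by exists (inl w). Qed.

End WeightedToSeparated.

(* Main.v *)
Require Import Defs.
From HB Require Import structures.
From mathcomp Require Import all_boot all_order all_algebra.
From mathcomp Require Import boolp classical_sets functions cardinality fsbigop.

Set Implicit Arguments.
Unset Strict Implicit.
Unset Printing Implicit Defensive.

Import GRing.Theory Defs.
Local Open Scope ring_scope.

(** The first isomorphism exists because the two algebras have, in effect, the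
    same generators and relations.  Each vertex v(e,i) of the separated graph is
    the target of exactly two edges, a = alpha^i(e) and b = alpha^e(i), so the
    generators tau(x,y) are tau(a,b), its adjoint tau(b,a), and the projections
    tau(a,a) and tau(b,b).  With e_i = tau(a,b) the last two are e_i e_i^* and
    e_i^* e_i, since the e_i are partial isometries ([Lab_pisom]).  Under this
    dictionary the blocks X(v,i) give the relations e_i^* f_i = 0 and the
    decompositions of v, and the blocks X(e) give e_i e_j^* = 0 and the
    decomposition of r(e).  Moreover the semigroups generated by the two families
    correspond, hence the tame quotients do as well ([Lab_iso_LVab]).

    For the second isomorphism, tau(x,y) is sent to x y^*.  The relations are
    easily checked, and the image is the whole corner: the algebra of the
    separated graph is spanned by the products l^* b r with b in the image and
    l, r vertices of the first part or edges, because a product l r^* of two such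
    elements falls back into the image ([LSab_row_mul], [LSab_blocks_all]).

    The substantial point is injectivity.  It comes from a representation of the
    abelianized algebra of the separated graph by matrices with coefficients in
    the algebra of the tau(x,y) ([LSab_matrices]): after the choice of an edge
    a(w) for each vertex w of the second part, the edge x is represented by the
    single entry tau(x,a(w)) in the column of its target w.  All words in the
    generators are represented by matrices with at most one nonzero entry, so
    their range projections commute as soon as they do in the coefficient algebra
    ([entry_set_tame]), and the representation factors through the tame quotient.
    On the image of an element b of the coefficient algebra it gives the matrix
    whose only entry is b, from which b is recovered.

    Matrices indexed by an infinite set are realized as operators on columns; the
    adjoint is carried along as a second operator.

    All homomorphisms out of presented tame algebras are built with
    [tame_pres_lift], which asks for the relations and for a set of elements
    with commuting range projections containing the images of the generators. *)

(** * Star-homomorphisms *)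

Section StarHom.
Variables (K : fieldType) (conj : involutive_rmorphism K).
Variables (A B : starAlgType conj) (f : A -> B).
Hypothesis fH : star_hom f.

Lemma hom_mul x y : f (x ** y) = f x ** f y.
Proof. by have [_ fM _] := fH. Qed.

Lemma hom_star x : f (x^*) = (f x)^*.
Proof. by have [_ _ fS] := fH. Qed.

Lemma hom_add x y : f (x + y) = f x + f y.
Proof. by have [fL _ _] := fH; have := fL 1 x y; rewrite !scale1r. Qed.

Lemma hom_zero : f 0 = 0.
Proof. by apply: (@addrI _ (f 0)); rewrite -hom_add !addr0. Qed.

Lemma hom_scale k x : f (k *: x) = k *: f x.
Proof. by have [fL _ _] := fH; have := fL k x 0; rewrite hom_zero !addr0. Qed.

Lemma hom_sub x y : f (x - y) = f x - f y.
Proof. by rewrite hom_add -scaleN1r hom_scale scaleN1r. Qed.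

Lemma hom_sum I (r : seq I) (P : pred I) F :
  f (\sum_(i <- r | P i) F i) = \sum_(i <- r | P i) f (F i).
Proof. exact: (big_morph f hom_add hom_zero). Qed.

Lemma hom_fsum (I : choiceType) (D : set I) F : finite_set D ->
  f (\sum_(i \in D) F i) = \sum_(i \in D) f (F i).
Proof. by move=> fD; rewrite !fsbig_finite // hom_sum. Qed.

Lemma hom_eproj x : f (eproj x) = eproj (f x).
Proof. by rewrite /eproj hom_mul hom_star. Qed.

End StarHom.

Lemma hom_id (K : fieldType) (conj : involutive_rmorphism K)
  (A : starAlgType conj) : star_hom (@id A).
Proof. by []. Qed.

Lemma hom_comp (K : fieldType) (conj : involutive_rmorphism K)
    (A B C : starAlgType conj) (f : A -> B) (g : B -> C) :
  star_hom f -> star_hom g -> star_hom (g \o f).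
Proof.
move=> fH gH; split=> [k x y|x y|x] /=.
- by rewrite hom_add // hom_scale // hom_add // hom_scale.
- by rewrite !hom_mul.
- by rewrite !hom_star.
Qed.

Lemma subalg_lift (K : fieldType) (conj : involutive_rmorphism K)
    (A B : starAlgType conj) (S : starSub B) (f : A -> B) :
  star_hom f -> (forall x, S (f x)) ->
  exists2 g : A -> subalg S, star_hom g & forall x, subval (g x) = f x.
Proof.
move=> fH Sf; pose g x : subalg S := SubAlg (asboolT (Sf x)).
exists g => //; split=> [k x y|x y|x]; apply: val_inj => /=.
- by rewrite hom_add // hom_scale.
- by rewrite hom_mul.
- by rewrite hom_star.
Qed.

(** * Presented tame algebras *)

(** The tameness condition on the multiplicative semigroup generated by a family
    is most easily checked on a larger set with an explicit description; this is
    what is asked of such a set. *)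
Definition tame_semigroup (K : fieldType) (conj : involutive_rmorphism K)
    (B : starAlgType conj) (P : set B) : Prop :=
  [/\ forall x y, P x -> P y -> P (x ** y), forall x, P x -> P (x^*) &
      forall x y, P x -> P y -> eproj x ** eproj y = eproj y ** eproj x].

Section TamePresentation.
Variables (K : fieldType) (conj : involutive_rmorphism K) (X : Type).
Variable R : free conj X -> free conj X -> Prop.
Local Notation F := (range (pgen R)).
Local Notation T := (tame_alg F).

Definition tgen (x : X) : T := tame_pi F (pgen R x).

Definition tpi (a : free conj X) : T :=
  tame_pi F (qpi (ideal_of (relators_star (R := R))) a).

Lemma tpi_hom : star_hom tpi.
Proof. by apply: (hom_comp (qpi_hom _) (qpi_hom _)). Qed.

Lemma tpi_rel a b : R a b -> tpi a = tpi b.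
Proof. by move=> Rab; rewrite /tpi (pres_rel Rab). Qed.

Lemma tame_pres_ind (P : T -> Prop) :
  (forall x, P (tgen x)) -> P 0 ->
  (forall a b, P a -> P b -> P (a + b)) -> (forall k a, P a -> P (k *: a)) ->
  (forall a b, P a -> P b -> P (a ** b)) -> (forall a, P a -> P (a^*)) ->
  forall a, P a.
Proof.
have piH := qpi_hom (tame_ideal F).
move=> Pg P0 PD PZ PM PS; elim/qpi_ind; elim/pres_ind=> //.
- by move=> a b Pa Pb; rewrite (hom_add piH); apply: PD.
- by move=> k a Pa; rewrite (hom_scale piH); apply: PZ.
- by move=> a b Pa Pb; rewrite (hom_mul piH); apply: PM.
- by move=> a Pa; rewrite (hom_star piH); apply: PS.
Qed.

Lemma tame_pres_hom_eq (B : starAlgType conj) (f g : T -> B) :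
  star_hom f -> star_hom g -> (forall x, f (tgen x) = g (tgen x)) -> f =1 g.
Proof.
move=> fH gH fg; elim/tame_pres_ind=> //.
- by rewrite (hom_zero fH) (hom_zero gH).
- by move=> a b fga fgb; rewrite (hom_add fH) (hom_add gH) fga fgb.
- by move=> k a fga; rewrite (hom_scale fH) (hom_scale gH) fga.
- by move=> a b fga fgb; rewrite (hom_mul fH) (hom_mul gH) fga fgb.
- by move=> a fga; rewrite (hom_star fH) (hom_star gH) fga.
Qed.

Definition tame_words : set T := tame_pi F @` star_semigroup F.

Lemma tgen_word x : tame_words (tgen x).
Proof. by exists (pgen R x) => //; apply: ss_in; exists x. Qed.

Lemma tame_words_tame : tame_semigroup tame_words.
Proof.
have piH := qpi_hom (tame_ideal F).
split.
- move=> _ _ [u Uu <-] [v Uv <-]; exists (u ** v); first exact: ss_mul.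
  exact: (hom_mul piH).
- move=> _ [u Uu <-]; exists (u^*); first exact: ss_star.
  exact: (hom_star piH).
- move=> _ _ [u Uu <-] [v Uv <-]; rewrite /tame_pi -!(hom_eproj piH) -!(hom_mul piH).
  by apply/qpiP/ig_in; exists u, v.
Qed.

(** The universal property: it is enough to send the generators to elements
    that satisfy the relations and lie in a common tame semigroup. *)
Lemma tame_pres_lift (B : starAlgType conj) (f : X -> B) (P : set B) :
  tame_semigroup P -> (forall x, P (f x)) ->
  (forall g : free conj X -> B, star_hom g -> (forall x, g (fgen conj x) = f x) ->
     forall a b, R a b -> g a = g b) ->
  exists2 h : T -> B, star_hom h & forall x, h (tgen x) = f x.
Proof.
move=> [PM PS Pc] Pf fR; have [g gH gE] := free_lift f.
have [h hH hE] := pres_lift gH (fR g gH gE).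
have Ph u : star_semigroup F u -> P (h u).
  elim=> {u} [_ [x _ <-]|u v _ Pu _ Pv|u _ Pu].
  - by rewrite hE gE.
  - by rewrite (hom_mul hH); apply: PM.
  - by rewrite (hom_star hH); apply: PS.
have [c /= Jc|k kH kE] := quot_lift (J := tame_ideal F) hH.
  elim: {c} Jc => [_ [u [v [Uu Uv ->]]]||x y _ hx _ hy|k x _ hx|a x _ hx|x a _ hx].
  - rewrite (hom_sub hH) (hom_mul hH (eproj u)) (hom_mul hH (eproj v)).
    by rewrite !(hom_eproj hH) (Pc _ _ (Ph u Uu) (Ph v Uv)) subrr.
  - exact: (hom_zero hH).
  - by rewrite (hom_add hH) hx hy addr0.
  - by rewrite (hom_scale hH) hx scaler0.
  - by rewrite (hom_mul hH) hx sa_mul0r.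
  - by rewrite (hom_mul hH) hx sa_mul0l.
by exists k => // x; rewrite /tgen /tame_pi kE hE gE.
Qed.

End TamePresentation.

(** * The algebra of the tau(e,f) of a bipartite separated graph *)

Section LVabTheory.
Variables (K : fieldType) (conj : involutive_rmorphism K) (F : bisepgraph).
Local Notation B := (LVab conj F).
Local Notation p := (LVab_p conj).
Local Notation tau := (LVab_tau conj).
Local Notation piH := (tpi_hom (LV_rel (conj := conj) (F := F))).

Lemma LVab_pp (v v' : bvertex0 F) : p v ** p v' = (v == v')%:R *: p v :> B.
Proof.
have := tpi_rel (LV_pp conj v v').
by rewrite (hom_mul piH) (hom_scale piH).
Qed.

Lemma LVab_pstar (v : bvertex0 F) : (p v)^* = p v :> B.
Proof. by have := tpi_rel (LV_pstar conj v); rewrite (hom_star piH). Qed.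

Lemma LVab_taustar (e f : bedge F) (ef : btgt e = btgt f) (fe : btgt f = btgt e) :
  (tau ef)^* = tau fe :> B.
Proof. by have := tpi_rel (LV_taustar conj ef fe); rewrite (hom_star piH). Qed.

Lemma LVab_taup (e f : bedge F) (ef : btgt e = btgt f) :
  tau ef ** p (bsrc f) = tau ef :> B.
Proof. by have := tpi_rel (LV_taup conj ef); rewrite (hom_mul piH). Qed.

Lemma LVab_ptau (e f : bedge F) (ef : btgt e = btgt f) :
  p (bsrc e) ** tau ef = tau ef :> B.
Proof. by have := tpi_rel (LV_ptau conj ef); rewrite (hom_mul piH). Qed.

Lemma LVab_tau_mul (e f h : bedge F) (ef : btgt e = btgt f)
  (fh : btgt f = btgt h) (eh : btgt e = btgt h) : tau ef ** tau fh = tau eh :> B.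
Proof.
(* Every edge lies in a block of the partition at its source. *)
have [Y sY Yf] : exists2 Y, bsep (bsrc f) Y & Y f.
  have [cv _ _] := bsepP (bsrc f).
  have : [set e | bsrc e = bsrc f]%classic f by [].
  by rewrite -cv => -[Y sY Yf]; exists Y.
by have := tpi_rel (LV_tau_mul conj ef fh eh sY Yf); rewrite (hom_mul piH).
Qed.

Lemma LVab_tau_mul0 (v : bvertex0 F) (Y : set (bedge F)) (e f g h : bedge F)
    (ef : btgt e = btgt f) (gh : btgt g = btgt h) :
  bsep v Y -> Y f -> Y g -> f <> g -> tau ef ** tau gh = 0 :> B.
Proof.
move=> sY Yf Yg fg; have := tpi_rel (LV_tau_mul0 conj ef gh sY Yf Yg fg).
by rewrite (hom_mul piH) (hom_zero piH).
Qed.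

Lemma LVab_sum (v : bvertex0 F) (Y : set (bedge F)) : bsep v Y -> finite_set Y ->
  p v = \sum_(e \in Y) tau (erefl (btgt e)) :> B.
Proof.
move=> sY fY; have := tpi_rel (LV_sum conj sY).
by rewrite (hom_fsum piH).
Qed.

Lemma LVab_tau_word (e f : bedge F) (ef : btgt e = btgt f) : tame_words (tau ef : B).
Proof. exact: (tgen_word _ (LVtau ef)). Qed.

End LVabTheory.

(** Edges with a common target have the same support, so a family of partial
    isometries indexed by the edges is enough to recover all the tau(e,f), as
    l(e) l(f)^*.  The generators of the Leavitt path algebra of the separated
    graph form such a family, but so do elements of the abelianized algebra of a
    weighted graph, where the supports n(w) are not new idempotents but lie in the
    algebra generated by the p(v) and the l(e) l(f)^*. *)
Record edge_family (K : fieldType) (conj : involutive_rmorphism K) (F : bisepgraph)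
    (B : starAlgType conj)
    (p : bvertex0 F -> B) (n : bvertex1 F -> B) (l : bedge F -> B) : Prop :=
  EdgeFamily {
  ef_pp : forall v v', p v ** p v' = (v == v')%:R *: p v;
  ef_pstar : forall v, (p v)^* = p v;
  ef_src : forall e, p (bsrc e) ** l e = l e;
  ef_tgt : forall e, l e ** n (btgt e) = l e;
  ef_norm : forall e, (l e)^* ** l e = n (btgt e);
  ef_orth : forall v Y e f, bsep v Y -> Y e -> Y f -> e <> f -> (l e)^* ** l f = 0;
  ef_sum : forall v Y, bsep v Y -> p v = \sum_(e \in Y) l e ** (l e)^*
}.

(** The middle factor of l(e) l(f)^* l(g) l(h)^* vanishes by orthogonality, or is
    the common support of the l(e) with that target and is absorbed. *)
Lemma LVab_lift (K : fieldType) (conj : involutive_rmorphism K) (F : bisepgraph)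
    (B : starAlgType conj) p n l (W : set B) :
  (forall v (Y : set (bedge F)), bsep v Y -> finite_set Y) ->
  edge_family p n l -> tame_semigroup W -> (forall v, W (p v)) -> (forall e, W (l e)) ->
  exists2 h : LVab conj F -> B, star_hom h &
    (forall v, h (LVab_p conj v) = p v) /\
    (forall (e f : bedge F) (ef : btgt e = btgt f),
       h (LVab_tau conj ef) = l e ** (l f)^*).
Proof.
move=> finF pl WT Wp Wl.
pose t (x : LV_gen F) : B :=
  match x with LVp v => p v | @LVtau _ e f _ => l e ** (l f)^* end.
have [h hH hE] : exists2 h : LVab conj F -> B, star_hom h &
    forall x, h (tgen (LV_rel (conj := conj) (F := F)) x) = t x.
  apply: (tame_pres_lift WT) => [[v|e f _] /=|g gH gE a b].
  - exact: Wp.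
  - by case: WT => WM WS _; apply: (WM _ _ (Wl e)); apply/WS/Wl.
  have lnr e : n (btgt e) ** (l e)^* = (l e)^*.
    by rewrite -{2}(ef_tgt pl e) sa_starM -(ef_norm pl e) sa_starM sa_starK.
  case.
  - by move=> v v'; rewrite (hom_mul gH) (hom_scale gH) !gE /= (ef_pp pl).
  - by move=> v; rewrite (hom_star gH) !gE /= (ef_pstar pl).
  - by move=> e f ef fe; rewrite (hom_star gH) !gE /= sa_starM sa_starK.
  - move=> e f ef; rewrite (hom_mul gH) !gE /= -sa_mulA.
    by rewrite -{1}(ef_pstar pl) -sa_starM (ef_src pl).
  - by move=> e f ef; rewrite (hom_mul gH) !gE /= sa_mulA (ef_src pl).
  - move=> v Y e f k ef fk ek _ _; rewrite (hom_mul gH) !gE /=.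
    by rewrite -sa_mulA (sa_mulA (l f)^*) (ef_norm pl) fk lnr.
  - move=> v Y e f k m ef km sY Yf Yk fk; rewrite (hom_mul gH) (hom_zero gH) !gE /=.
    by rewrite -sa_mulA (sa_mulA (l f)^*) (ef_orth pl sY) // sa_mul0l sa_mul0r.
  - move=> v Y sY; rewrite (hom_fsum gH) ?gE /=; last exact: finF sY.
    by rewrite (ef_sum pl sY); apply: eq_fsbigr => e _; rewrite gE.
exists h => //; split=> [v|e f ef]; first exact: (hE (LVp v)).
exact: (hE (LVtau ef)).
Qed.

(** * The abelianized Leavitt path algebra *)

Section LabTheory.
Variables (K : fieldType) (conj : involutive_rmorphism K) (E : weighted_graph).
Local Notation B := (Lab conj E).
Local Notation vx := (Lab_vertex conj).
Local Notation ed := (Lab_edge conj).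
Local Notation piH := (tpi_hom (L1_rel (conj := conj) (E := E))).

Lemma Lab_vv (u v : vertex E) : vx u ** vx v = (u == v)%:R *: vx u :> B.
Proof.
by have := tpi_rel (L1_vv conj u v); rewrite (hom_mul piH) (hom_scale piH).
Qed.

Lemma Lab_vstar (v : vertex E) : (vx v)^* = vx v :> B.
Proof. by have := tpi_rel (L1_vstar conj v); rewrite (hom_star piH). Qed.

Lemma Lab_src (e : edge E) (i : 'I_(weight e)) : vx (src e) ** ed i = ed i :> B.
Proof. by have := tpi_rel (L1_src conj i); rewrite (hom_mul piH). Qed.

Lemma Lab_tgt (e : edge E) (i : 'I_(weight e)) : ed i ** vx (tgt e) = ed i :> B.
Proof. by have := tpi_rel (L1_tgt conj i); rewrite (hom_mul piH). Qed.

Lemma Lab_ee (e : edge E) (i j : 'I_(weight e)) : i <> j -> ed i ** (ed j)^* = 0 :> B.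
Proof.
move=> ij; have := tpi_rel (L1_ee conj ij).
by rewrite (hom_mul piH) (hom_star piH) (hom_zero piH).
Qed.

Lemma Lab_ef (e f : edge E) (i : 'I_(weight e)) (j : 'I_(weight f)) :
  src e = src f -> e <> f -> i = j :> nat -> (ed i)^* ** ed j = 0 :> B.
Proof.
move=> sef ef ij; have := tpi_rel (L1_ef conj sef ef ij).
by rewrite (hom_mul piH) (hom_star piH) (hom_zero piH).
Qed.

Lemma Lab_in (e : edge E) : vx (tgt e) = \sum_(i < weight e) (ed i)^* ** ed i :> B.
Proof.
have inE : tpi _ _ = vx (tgt e) := tpi_rel (L1_in conj e).
rewrite -inE (hom_sum piH).
by apply: eq_bigr => i _; rewrite (hom_mul piH) (hom_star piH).
Qed.

Lemma finite_wedge (D : set (edge E)) :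
  finite_set D -> finite_set [set g : wedge E | D (tag g)]%classic.
Proof.
move=> finD; apply: (@sub_finite_set _ _ (\bigcup_(e in D)
    [set Tagged (fun e => 'I_(weight e)) i | i in [set: 'I_(weight e)]])%classic).
  by move=> [e i] /= De; exists e => //; exists i.
apply: bigcup_finite => // e _; apply: finite_image.
exact: finite_finset.
Qed.

Lemma Lab_out (v : vertex E) k : (k < vweight v)%N ->
  vx v = \sum_(g \in [set g : wedge E | src (tag g) = v /\ tagged g = k :> nat]%classic)
           ed (tagged g) ** (ed (tagged g))^* :> B.
Proof.
move=> kv; have nv : (out_edges v !=set0)%classic.
  by have [e ev _] := vweight_lt kv; exists e.
have outE : tpi _ _ = vx v := tpi_rel (L1_out conj nv kv).
rewrite -outE (hom_fsum piH).
  by apply: eq_fsbigr => g _; rewrite (hom_mul piH) (hom_star piH).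
apply: sub_finite_set (finite_wedge (wgraph_row_finite (w := E) v)).
by move=> g [].
Qed.

(** Multiply the relation for r(e) by e_i on the left: the terms of index j
    different from i vanish because e_i e_j^* = 0. *)
Lemma Lab_pisom (e : edge E) (i : 'I_(weight e)) : ed i ** (ed i)^* ** ed i = ed i :> B.
Proof.
rewrite -[RHS]Lab_tgt Lab_in (big_morph (sa_mul (ed i)) (sa_mulDr _) (sa_mul0r _)).
rewrite (bigD1 i) //= big1 ?addr0 ?sa_mulA // => j /eqP ij.
by rewrite sa_mulA Lab_ee ?sa_mul0l // => /esym.
Qed.

End LabTheory.

(** * The bipartite separated graph of a weighted graph *)

Lemma E1_Xv_sum (E : weighted_graph) (V : nmodType) v k (f : E1_edge E -> V) :
  \sum_(x \in E1_Xv v k) f x =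
  \sum_(g \in [set g : wedge E | src (tag g) = v /\ tagged g = k :> nat]%classic)
     f (inl g).
Proof.
apply: reindex_fsbig; split=> [[e i] [/= ev ik]|x y _ _ [] //|x [e [i [ev ik ->]]]].
  by exists e, i.
by exists (Tagged (fun e => 'I_(weight e)) i).
Qed.

Lemma E1_Xe_sum (E : weighted_graph) (V : nmodType) e (f : E1_edge E -> V) :
  \sum_(x \in E1_Xe e) f x = \sum_(i < weight e) f (alpha_dn i).
Proof.
rewrite (fsbig_seq _ _ (index_enum_uniq _)); apply: reindex_fsbig.
split=> [i _|i j _ _ [] /eqP|x [i ->]]; first by exists i.
  by rewrite eq_Tagged => /eqP.
by exists i => //=; apply: mem_index_enum.
Qed.

Section WeightedSeparated.
Variables (K : fieldType) (conj : involutive_rmorphism K) (E : weighted_graph).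
Local Notation A := (Lab conj E).
Local Notation B := (LVab conj (E1 E)).
Local Notation vx := (@Lab_vertex K conj E).
Local Notation ed := (@Lab_edge K conj E _).

(** The vertex v(e,i) receives the two edges alpha^i(e) and alpha^e(i) only.
    Choosing the second one to stand for the vertex, alpha^e(i) becomes the
    projection e_i^* e_i and alpha^i(e) becomes e_i. *)
Definition Lab_support (g : wedge E) : A := (ed (tagged g))^* ** ed (tagged g).

Definition Lab_leg (x : bedge (E1 E)) : A :=
  match x with inl g => ed (tagged g) | inr g => Lab_support g end.

(** The blocks X(v,i) carry the relations at the source v of the edges, and the
    blocks X(e) those between the e_i of one edge e. *)
Lemma Lab_leg_family : edge_family (F := E1 E) vx Lab_support Lab_leg.
Proof.
have supp_star g : (Lab_support g)^* = Lab_support g.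
  by rewrite /Lab_support sa_starM sa_starK.
have supp_pisom g : ed (tagged g) ** Lab_support g = ed (tagged g).
  by rewrite /Lab_support sa_mulA Lab_pisom.
have supp_idem g : Lab_support g ** Lab_support g = Lab_support g.
  by rewrite {1}/Lab_support -sa_mulA supp_pisom.
split.
- exact: Lab_vv.
- exact: Lab_vstar.
- case=> g /=; first exact: Lab_src.
  rewrite /Lab_support sa_mulA; congr (_ ** _).
  by rewrite -{1}(Lab_vstar conj) -sa_starM Lab_tgt.
- by case=> g /=.
- by case=> g //=; rewrite supp_star supp_idem.
- move=> v Y x y [[k _ ->]|[e _ ->]].
    move=> [e [i [ev ik ->]]] [f [j [fv jk ->]]] xy /=; apply: Lab_ef.
    + by rewrite ev.
    + move=> ef; case: f / ef j fv jk xy => j _ jk; apply.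
      by congr alpha_up; apply: val_inj; exact: etrans ik (esym jk).
    + by rewrite ik.
  move=> [i ->] [j ->] ij /=; rewrite supp_star /Lab_support /=.
  rewrite -sa_mulA (sa_mulA _ _^* _) Lab_ee ?sa_mul0l ?sa_mul0r // => ij'.
  by apply: ij; rewrite ij'.
- move=> v Y [[k kv ->]|[e ev ->]]; first by rewrite E1_Xv_sum (Lab_out _ kv).
  rewrite E1_Xe_sum -ev Lab_in.
  by apply: eq_bigr => i _; rewrite supp_star supp_idem.
Qed.

Lemma E1_sep_finite : locally_finite E ->
  forall v (Y : set (bedge (E1 E))), bsep v Y -> finite_set Y.
Proof.
move=> lfE v Y sY; apply: (@sub_finite_set _ _ [set a | @bsrc (E1 E) a = v]%classic).
  by have [<- _ _] := bsepP v; move=> a Ya; exists Y.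
apply: sub_finite_set (E1_row_finite lfE (inl v)) => a /= av.
by rewrite /out_edges /= av.
Qed.

Local Notation p := (LVab_p conj (F := E1 E)).
Local Notation tau := (LVab_tau conj (F := E1 E)).

Lemma Lab_to_LVab : locally_finite E ->
  exists2 phi : A -> B, star_hom phi &
    (forall v, phi (vx v) = p v) /\
    (forall e (i : 'I_(weight e)),
       phi (ed i) = tau (e := alpha_up i) (f := alpha_dn i) erefl).
Proof.
move=> lfE; have finE := E1_sep_finite lfE.
pose t (x : L1_gen E) : B := match x with
  | L1v v => p v | @L1e _ e i => tau (e := alpha_up i) (f := alpha_dn i) erefl end.
have [h hH hE] : exists2 h : A -> B, star_hom h &
    forall x, h (tgen (L1_rel (conj := conj) (E := E)) x) = t x.
  apply: (tame_pres_lift (tame_words_tame _)) => [[v|e i]|g gH gE a b].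
  - exact: (tgen_word _ (LVp _)).
  - exact: LVab_tau_word.
  have sE e (i : 'I_(weight e)) :
      (tau (e := alpha_up i) (f := alpha_dn i) erefl)^* =
      tau (e := alpha_dn i) (f := alpha_up i) erefl.
    exact: LVab_taustar.
  have Xup e (i : 'I_(weight e)) : bsep (b := E1 E) (src e) (E1_Xv (src e) i).
    by left; exists i => //; rewrite (leq_trans (ltn_ord i)) ?weight_le_vweight.
  have Xdn e : bsep (b := E1 E) (tgt e) (E1_Xe e) by right; exists e.
  case.
  - by move=> u v; rewrite (hom_mul gH) (hom_scale gH) !gE /= LVab_pp.
  - by move=> v; rewrite (hom_star gH) !gE /= LVab_pstar.
  - move=> e i; rewrite (hom_mul gH) !gE /=.
    exact: (LVab_ptau conj (F := E1 E) (e := alpha_up i)).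
  - move=> e i; rewrite (hom_mul gH) !gE /=.
    exact: (LVab_taup conj (F := E1 E) (f := alpha_dn i)).
  - move=> e i j ij; rewrite (hom_mul gH) (hom_star gH) (hom_zero gH) !gE /= sE.
    apply: (LVab_tau_mul0 conj (F := E1 E) _ _ (Xdn e)); [by exists i|by exists j|].
    by case=> /eqP; rewrite eq_Tagged => /eqP.
  - move=> e f i j sef ef ij.
    rewrite (hom_mul gH) (hom_star gH) (hom_zero gH) !gE /= sE.
    apply: (LVab_tau_mul0 conj (F := E1 E) _ _ (Xup e i)); first by exists e, i.
      by exists f, j; split=> //; rewrite ?ij.
    by case=> /ef.
  - move=> v k nv kv; rewrite (hom_fsum gH) ?gE /=; last first.
      apply: sub_finite_set (finite_wedge (wgraph_row_finite (w := E) v)).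
      by move=> g' [].
    rewrite (@LVab_sum _ conj (E1 E) v (E1_Xv v k)); last 2 first.
    + by left; exists k.
    + by apply: (finE v); left; exists k.
    rewrite E1_Xv_sum; apply: eq_fsbigr => -[e i] _.
    rewrite (hom_mul gH) (hom_star gH) !gE /= sE.
    exact: (LVab_tau_mul conj (F := E1 E)).
  - move=> e; rewrite (hom_sum gH) gE /=.
    rewrite (@LVab_sum _ conj (E1 E) _ _ (Xdn e)); last exact: finE (Xdn e).
    rewrite E1_Xe_sum; apply: eq_bigr => i _.
    rewrite (hom_mul gH) (hom_star gH) !gE /= sE.
    exact: (LVab_tau_mul conj (F := E1 E)).
exists h => //; split=> [v|e i]; [exact: (hE (L1v v)) | exact: (hE (L1e i))].
Qed.

(** The inverse sends tau(x,y) to the product of the leg of x and the adjoint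
    of the leg of y; the legs are chosen so that this product is e_i, e_i^*,
    e_i e_i^* or e_i^* e_i according to the types of x and y. *)
Lemma Lab_iso_LVab : locally_finite E ->
  exists2 phi : A -> B, star_iso phi &
    (forall v, phi (vx v) = p v) /\
    (forall e (i : 'I_(weight e)),
       phi (ed i) = tau (e := alpha_up i) (f := alpha_dn i) erefl).
Proof.
move=> lfE; have [phi phiH [phiv phie]] := Lab_to_LVab lfE.
have Wv v : tame_words (vx v) by apply: (tgen_word _ (L1v v)).
have Wleg x : tame_words (Lab_leg x).
  have We (g : wedge E) : tame_words (ed (tagged g)).
    exact: (tgen_word _ (L1e (tagged g))).
  have [WM WS _] := tame_words_tame (L1_rel (conj := conj) (E := E)).
  by case: x => g; [exact: We | apply: WM; [apply: WS|]; exact: We].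
have [h hH [hp htau]] :=
  LVab_lift (E1_sep_finite lfE) Lab_leg_family (tame_words_tame _) Wv Wleg.
exists phi => //; split=> //; exists h.
- apply: (tame_pres_hom_eq (hom_comp phiH hH) (hom_id A)) => -[v|e i] /=.
    by rewrite [X in h X]phiv hp.
  rewrite [X in h X]phie htau /= /Lab_support sa_starM sa_starK sa_mulA.
  exact: Lab_pisom.
- have phi_star e (i : 'I_(weight e)) :
      phi (ed i)^* = tau (e := alpha_dn i) (f := alpha_up i) erefl.
    by rewrite (hom_star phiH) phie; apply: LVab_taustar.
  (* The leg of x is tau(x,alpha^e(i)), where v(e,i) is the target of x. *)
  have phi_leg x : phi (Lab_leg x) = tau (e := x) (f := inr (btgt x)) erefl.
    case: x => -[e i] /=; first exact: phie.
    rewrite /Lab_support (hom_mul phiH) phi_star phie.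
    exact: (LVab_tau_mul conj (F := E1 E)).
  have tau_star x : (tau (e := x) (f := inr (btgt x)) erefl)^* =
      tau (e := inr (btgt x)) (f := x) erefl by apply: LVab_taustar.
  apply: (tame_pres_hom_eq (hom_comp hH phiH) (hom_id B)) => -[v|x y xy] /=.
    by rewrite [X in phi X]hp phiv.
  rewrite [X in phi X]htau (hom_mul phiH) (hom_star phiH) !phi_leg tau_star.
  by case: x y xy => g [] g' /= gg'; case: g' / gg'; apply: LVab_tau_mul.
Qed.

End WeightedSeparated.

(** * Operators with a formal adjoint *)

(** Pairs of endomorphisms of a vector space, multiplied as End(V) x End(V)^op and
    exchanged by the involution.  This turns every vector space V, with no inner
    product on it, into a source of star-algebras: a representation of a
    star-algebra on V becomes a star-homomorphism once x^* is taken for the second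
    component. *)
Record biop (K : fieldType) (conj : involutive_rmorphism K) (V : lmodType K) := Biop {
  op : V -> V;
  adj : V -> V;
  op_linear : linear op;
  adj_linear : linear adj
}.

HB.instance Definition _ K conj V := gen_eqMixin (@biop K conj V).
HB.instance Definition _ K conj V := gen_choiceMixin (@biop K conj V).

Section Biop.
Variables (K : fieldType) (conj : involutive_rmorphism K) (V : lmodType K).
Local Notation biop := (@biop K conj V).
Implicit Types a b c : biop.

Lemma biopP a b : op a =1 op b -> adj a =1 adj b -> a = b.
Proof.
case: a b => f f' fL fL' [g g' gL gL'] /= /funext fg /funext fg'.
case: g / fg gL; case: g' / fg' gL' => gL' gL.
by congr Biop; apply: Prop_irrelevance.
Qed.

Lemma linear_fun0 : linear (fun _ : V => 0 : V).
Proof. by move=> k x y; rewrite scaler0 addr0. Qed.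

Lemma linear_funD (f g : V -> V) : linear f -> linear g -> linear (fun x => f x + g x).
Proof. by move=> fL gL k x y; rewrite fL gL scalerDr addrACA. Qed.

Lemma linear_funZ l (f : V -> V) : linear f -> linear (fun x => l *: f x).
Proof. by move=> fL k x y; rewrite fL scalerDr !scalerA mulrC. Qed.

Lemma linear_funM (f g : V -> V) : linear f -> linear g -> linear (f \o g).
Proof. by move=> fL gL k x y /=; rewrite gL fL. Qed.

Lemma linear_fun_add (f : V -> V) x y : linear f -> f (x + y) = f x + f y.
Proof. by move=> fL; have := fL 1 x y; rewrite !scale1r. Qed.

Lemma linear_fun_scale (f : V -> V) k x : linear f -> f (k *: x) = k *: f x.
Proof.
move=> fL; have f0 : f 0 = 0.
  by apply: (@addrI _ (f 0)); rewrite -linear_fun_add // !addr0.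
by have := fL k x 0; rewrite f0 !addr0.
Qed.

Definition biop_zero : biop := Biop conj linear_fun0 linear_fun0.
Definition biop_add a b : biop := Biop conj
  (linear_funD (@op_linear _ _ _ a) (@op_linear _ _ _ b))
  (linear_funD (@adj_linear _ _ _ a) (@adj_linear _ _ _ b)).
Definition biop_scale k a : biop := Biop conj
  (linear_funZ k (@op_linear _ _ _ a)) (linear_funZ (conj k) (@adj_linear _ _ _ a)).
Definition biop_opp a : biop := biop_scale (-1) a.
Definition biop_mul a b : biop := Biop conj
  (linear_funM (@op_linear _ _ _ a) (@op_linear _ _ _ b))
  (linear_funM (@adj_linear _ _ _ b) (@adj_linear _ _ _ a)).
Definition biop_star a : biop := Biop conj (@adj_linear _ _ _ a) (@op_linear _ _ _ a).

Fact biop_addA : associative biop_add.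
Proof. by move=> a b c; apply: biopP => x /=; rewrite addrA. Qed.
Fact biop_addC : commutative biop_add.
Proof. by move=> a b; apply: biopP => x /=; rewrite addrC. Qed.
Fact biop_add0 : left_id biop_zero biop_add.
Proof. by move=> a; apply: biopP => x /=; rewrite add0r. Qed.
Fact biop_addN : left_inverse biop_zero biop_opp biop_add.
Proof. by move=> a; apply: biopP => x /=; rewrite ?rmorphN1 scaleN1r addNr. Qed.

HB.instance Definition _ :=
  GRing.isZmodule.Build biop biop_addA biop_addC biop_add0 biop_addN.

Fact biop_scaleA k l a : biop_scale k (biop_scale l a) = biop_scale (k * l) a.
Proof. by apply: biopP => x /=; rewrite scalerA ?rmorphM. Qed.
Fact biop_scale1 : left_id 1 biop_scale.
Proof. by move=> a; apply: biopP => x /=; rewrite ?rmorph1 scale1r. Qed.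
Fact biop_scaleDr : right_distributive biop_scale +%R.
Proof. by move=> k a b; apply: biopP => x /=; rewrite scalerDr. Qed.
Fact biop_scaleDl a : {morph biop_scale^~ a : k l / k + l}.
Proof. by move=> k l; apply: biopP => x /=; rewrite ?rmorphD scalerDl. Qed.

HB.instance Definition _ :=
  GRing.Zmodule_isLmodule.Build K biop biop_scaleA biop_scale1
    biop_scaleDr biop_scaleDl.

Fact biop_mulA : associative biop_mul.
Proof. by move=> a b c; apply: biopP. Qed.
Fact biop_mulDl a b c : biop_mul (a + b) c = biop_mul a c + biop_mul b c.
Proof.
by apply: biopP => x //=; rewrite linear_fun_add //; apply: adj_linear.
Qed.
Fact biop_mulDr a b c : biop_mul a (b + c) = biop_mul a b + biop_mul a c.
Proof.
by apply: biopP => x //=; rewrite linear_fun_add //; apply: op_linear.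
Qed.
Fact biop_scalel k a b : biop_mul (k *: a) b = k *: biop_mul a b.
Proof.
by apply: biopP => x //=; rewrite linear_fun_scale //; apply: adj_linear.
Qed.
Fact biop_scaler k a b : biop_mul a (k *: b) = k *: biop_mul a b.
Proof.
by apply: biopP => x //=; rewrite linear_fun_scale //; apply: op_linear.
Qed.
Fact biop_starK : involutive biop_star.
Proof. by move=> a; apply: biopP. Qed.
Fact biop_starD : {morph biop_star : a b / a + b}.
Proof. by move=> a b; apply: biopP. Qed.
Fact biop_starZ k a : biop_star (k *: a) = conj k *: biop_star a.
Proof. by apply: biopP => x //=; rewrite rmorphK. Qed.
Fact biop_starM a b : biop_star (biop_mul a b) = biop_mul (biop_star b) (biop_star a).
Proof. by apply: biopP. Qed.

HB.instance Definition _ := isStarAlg.Build K conj biop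
  biop_mulA biop_mulDl biop_mulDr biop_scalel biop_scaler
  biop_starK biop_starD biop_starZ biop_starM.

End Biop.

(** * Matrices with coefficients in an algebra *)

Section MatrixUnits.
Variables (K : fieldType) (conj : involutive_rmorphism K).
Variables (I : eqType) (B : starAlgType conj).
Implicit Types (i j k l : I) (b c : B).

(** The entries of the columns lie in the unitization of B, and not in B, in order
    that left multiplication be faithful. *)
Definition column : lmodType K := I -> (K^o * B)%type.

Definition entry_fun i j b (x : column) : column :=
  fun k => if k == i then (0, ((x j).1 : K) *: b + b ** (x j).2) else 0.

Lemma entry_fun_linear i j b : linear (entry_fun i j b).
Proof.
move=> k x y; apply/funext => m; rewrite /entry_fun !fctE /=.
case: eqP => _; last by rewrite scaler0 addr0.
apply/esym; congr pair => /=; first by rewrite scaler0 addr0.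
by rewrite scalerDr scalerDl scalerA sa_mulDr sa_scaler addrACA.
Qed.

Lemma entry_funM i j k l b c x :
  entry_fun i j b (entry_fun k l c x) =
  if j == k then entry_fun i l (b ** c) x else 0.
Proof.
apply/funext => m; rewrite /entry_fun; case: (j =P k) => _ /=; case: eqP => // _.
  by rewrite scale0r add0r sa_mulDr sa_scaler sa_mulA.
by rewrite scale0r sa_mul0r addr0.
Qed.

(** The matrix with entry b at (i,j) and zero elsewhere, as an operator.  Products
    of operators make sense for every I, whereas matrices indexed by an infinite I
    would have to be finitely supported. *)
Definition entry i j b : biop conj column :=
  Biop conj (entry_fun_linear i j b) (entry_fun_linear j i (b^*)).

Lemma entry_star i j b : (entry i j b)^* = entry j i (b^*).
Proof. by apply: biopP => x //=; rewrite sa_starK. Qed.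

Lemma entry_mul i j k l b c :
  entry i j b ** entry k l c = if j == k then entry i l (b ** c) else 0.
Proof.
apply: biopP => x /=; rewrite entry_funM; first by case: ifP.
by rewrite eq_sym -sa_starM; case: ifP.
Qed.

Lemma entry_linear i j : linear (entry i j).
Proof.
move=> k b c; apply: biopP => x; apply/funext => m.
  rewrite /= /entry_fun !fctE; case: eqP => _; last by rewrite scaler0 addr0.
  apply/esym; congr pair => /=; first by rewrite scaler0 addr0.
  by rewrite scalerDr scalerA mulrC -scalerA scalerDr sa_mulDl sa_scalel addrACA.
rewrite /= /entry_fun !fctE; case: eqP => _; last by rewrite scaler0 addr0.
apply/esym; congr pair => /=; first by rewrite scaler0 addr0.
rewrite sa_starD sa_starZ.
by rewrite scalerDr scalerA mulrC -scalerA scalerDr sa_mulDl sa_scalel addrACA.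
Qed.

Lemma entry_diag_hom i : star_hom (entry i i).
Proof.
split; first exact: entry_linear.
- by move=> b c; rewrite entry_mul eqxx.
- by move=> b; rewrite entry_star.
Qed.

Lemma entry_zero i j : entry i j 0 = 0.
Proof.
have := entry_linear i j (-1) 0 0; rewrite scaler0 addr0 => ->.
by rewrite scaleN1r addNr.
Qed.

(** The unit in the entries of a column is what makes b visible in the product. *)
Lemma entry_inj i j : injective (entry i j).
Proof.
move=> b c /(congr1 (fun a => (op a (fun _ => (1, 0)) i).2)) /=.
by rewrite /entry_fun eqxx /= !scale1r !sa_mul0r !addr0.
Qed.

Definition entry_set (W : set B) : set (biop conj column) :=
  [set a | a = 0 \/ exists i j b, W b /\ a = entry i j b]%classic.

(** The range projection of an entry is diagonal, so that two of them commute
    either for lack of a common index or because they do so in B. *)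
Lemma entry_set_tame (W : set B) : tame_semigroup W -> tame_semigroup (entry_set W).
Proof.
move=> [WM WS Wc]; split.
- move=> x y [->|[i [j [b [Wb ->]]]]]; first by left; rewrite sa_mul0l.
  move=> [->|[k [l [c [Wc' ->]]]]]; first by left; rewrite sa_mul0r.
  rewrite entry_mul; case: eqP => _; last by left.
  by right; exists i, l, (b ** c); split=> //; apply: WM.
- move=> _ [->|[i [j [b [Wb ->]]]]]; first by left; rewrite sa_star0.
  by right; exists j, i, (b^*); split; [apply: WS | rewrite entry_star].
- have eproj0 : eproj (0 : biop conj column) = 0 by rewrite /eproj sa_mul0l.
  have eproj_mono i j b : eproj (entry i j b) = entry i i (eproj b).
    by rewrite /eproj entry_star entry_mul eqxx.
  move=> x y [->|[i [j [b [Wb ->]]]]]; first by rewrite eproj0 sa_mul0l sa_mul0r.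
  move=> [->|[k [l [c [Wc' ->]]]]]; first by rewrite eproj0 sa_mul0l sa_mul0r.
  rewrite !eproj_mono !entry_mul (eq_sym k); case: eqP => [->|//].
  by rewrite Wc.
Qed.

End MatrixUnits.

(** * The corner cut by the sources of a bipartite separated graph *)

Section CornerIso.
Variables (K : fieldType) (conj : involutive_rmorphism K) (F : bisepgraph).
Hypothesis finF : forall v (Y : set (bedge F)), bsep v Y -> finite_set Y.
Hypothesis tgt_surj : forall w : bvertex1 F, exists e : bedge F, btgt e = w.

Local Notation L := (LSab conj F).
Local Notation B := (LVab conj F).
Local Notation v0 v := (LSab_vertex conj (F := F) (inl v)).
Local Notation v1 w := (LSab_vertex conj (F := F) (inr w)).
Local Notation ed := (LSab_edge conj (F := F)).
Local Notation p := (LVab_p conj (F := F)).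
Local Notation tau := (LVab_tau conj (F := F)).
Local Notation piH := (tpi_hom (LS_rel (conj := conj) (F := F))).

Lemma LSab_vv (u v : vertex F) :
  LSab_vertex conj u ** LSab_vertex conj v = (u == v)%:R *: LSab_vertex conj u.
Proof.
by have := tpi_rel (LS_vv conj u v); rewrite (hom_mul piH) (hom_scale piH).
Qed.

Lemma LSab_src (e : bedge F) : v0 (bsrc e) ** ed e = ed e.
Proof. by have := tpi_rel (LS_src conj (F := F) e); rewrite (hom_mul piH). Qed.

Lemma LSab_tgt (e : bedge F) : ed e ** v1 (btgt e) = ed e.
Proof. by have := tpi_rel (LS_tgt conj (F := F) e); rewrite (hom_mul piH). Qed.

Lemma LSab_ef v (Y : set (bedge F)) e f : bsep v Y -> Y e -> Y f ->
  (ed e)^* ** ed f = (e == f)%:R *: v1 (btgt e).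
Proof.
move=> sY Ye Yf; have := tpi_rel (LS_ef conj (F := F) (v := inl v) sY Ye Yf).
by rewrite (hom_mul piH) (hom_star piH) (hom_scale piH).
Qed.

Lemma LSab_sum v (Y : set (bedge F)) :
  bsep v Y -> v0 v = \sum_(e \in Y) ed e ** (ed e)^*.
Proof.
move=> sY; have fY := finF sY.
have sumE : v0 v = tpi _ _ := tpi_rel (LS_sum conj (F := F) (v := inl v) sY fY).
rewrite sumE (hom_fsum piH) //.
by apply: eq_fsbigr => e _; rewrite (hom_mul piH) (hom_star piH).
Qed.

Lemma LSab_edge_family : edge_family (fun v => v0 v) (fun w => v1 w) ed.
Proof.
split.
- by move=> v v'; apply: LSab_vv.
- by move=> v; apply: LSab_vertex_star.
- exact: LSab_src.
- exact: LSab_tgt.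
- move=> e; have [cv _ _] := bsepP (bsrc e).
  have : [set f | bsrc f = bsrc e]%classic e by [].
  by rewrite -cv => -[Y sY Ye]; rewrite (LSab_ef sY) // eqxx scale1r.
- by move=> v Y e f sY Ye Yf /eqP/negbTE ef; rewrite (LSab_ef sY) // ef scale0r.
- exact: LSab_sum.
Qed.

Local Notation I := (option (bvertex1 F)).
Local Notation M := (entry (conj := conj) (I := I) (B := B)).

(** One index, None, is shared by all the vertices of the first part, whose
    projections p(v) are told apart by the coefficients; each vertex w of the
    second part has an index of its own.  With an edge a(w) of target w chosen for
    each w, an edge e of target w acts as the entry tau(e,a(w)) in row None and
    column w, and w acts as the diagonal entry tau(a(w),a(w)).  The monomial matrices
    form a tame semigroup, so that this defines a representation of the
    abelianized algebra itself.  The (None,None) entry then recovers the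
    coefficient algebra from the corner. *)
Lemma LSab_matrices : exists2 rho : L -> biop conj (column I B), star_hom rho &
  (forall v, rho (v0 v) = M None None (p v)) /\
  (forall e f (ef : btgt e = btgt f), rho (ed e ** (ed f)^*) = M None None (tau ef)).
Proof.
have [a aE] := choice tgt_surj.
have aE' e : btgt e = btgt (a (btgt e)) by rewrite aE.
pose t (x : LS_gen F) : biop conj (column I B) := match x with
  | LSv (inl v) => M None None (p v)
  | LSv (inr w) => M (Some w) (Some w) (tau (erefl (btgt (a w))))
  | LSe e => M None (Some (btgt e)) (tau (aE' e)) end.
have [h hH hE] : exists2 h : L -> biop conj (column I B), star_hom h &
    forall x, h (tgen (LS_rel (conj := conj) (F := F)) x) = t x.
  have WT := tame_words_tame (LV_rel (conj := conj) (F := F)).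
  apply: (tame_pres_lift (entry_set_tame _ WT)) => [[[v|w]|e]|g gH gE x y].
  - right; exists None, None, (p v); split=> //; exact: (tgen_word _ (LVp v)).
  - by right; do 3 eexists; split; last reflexivity; apply: LVab_tau_word.
  - by right; do 3 eexists; split; last reflexivity; apply: LVab_tau_word.
  have M0 i j : M i j 0 = 0 by apply: entry_zero.
  have diagH : star_hom (M None None) by apply: entry_diag_hom.
  case.
  - move=> [v|w] [v'|w']; rewrite (hom_mul gH) (hom_scale gH) !gE /= entry_mul /=.
    + by rewrite LVab_pp (hom_scale diagH).
    + by rewrite scale0r.
    + by rewrite scale0r.
    + rewrite !(inj_eq (@Some_inj _)) !(inj_eq (@inr_inj _ _)).
      case: eqP => [<-|_]; last by rewrite scale0r.
      by rewrite scale1r (LVab_tau_mul _ _ _ erefl).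
  - move=> [v|w]; rewrite (hom_star gH) !gE /= entry_star ?LVab_pstar //.
    by rewrite (LVab_taustar _ _ erefl).
  - move=> e; rewrite (hom_mul gH) !gE /= entry_mul /=.
    by rewrite LVab_ptau.
  - move=> e; rewrite (hom_mul gH) !gE /= entry_mul eqxx.
    by rewrite (LVab_tau_mul _ _ _ (aE' e)).
  - move=> [v|w] Y e f //= sY Ye Yf.
    rewrite (hom_mul gH) (hom_star gH) (hom_scale gH) !gE /= entry_star entry_mul /=.
    rewrite (LVab_taustar _ _ (esym (aE' e))).
    case: eqP => [<-|ef].
      by rewrite scale1r (LVab_tau_mul _ _ _ erefl).
    by rewrite scale0r (LVab_tau_mul0 _ _ _ sY Ye Yf ef) M0.
  - move=> [v|w] Y //= sY fY; rewrite (hom_fsum gH) // gE /=.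
    rewrite (LVab_sum _ sY fY) (hom_fsum diagH) //.
    apply: eq_fsbigr => e _; rewrite (hom_mul gH) (hom_star gH) !gE /=.
    rewrite entry_star entry_mul eqxx (LVab_taustar _ _ (esym (aE' e))).
    by rewrite (LVab_tau_mul _ _ _ erefl).
exists h => //; split=> [v|e f ef]; first exact: (hE (@LSv F (inl v))).
have hed e' : h (ed e') = t (@LSe F e') by apply: (hE (@LSe F e')).
have fE : btgt f = btgt (a (btgt e)) by rewrite aE.
have {}hedf : h (ed f) = M None (Some (btgt e)) (tau fE).
  rewrite hed /=; move: fE; rewrite ef => fE; congr (M _ _ (tau _)).
  exact: Prop_irrelevance.
rewrite (hom_mul hH) (hom_star hH) hedf hed /= entry_star entry_mul eqxx.
by rewrite (LVab_taustar _ _ (esym fE)) (LVab_tau_mul _ _ _ ef).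
Qed.

(** In the representation by matrices these are supported in row None, so a
    product of one of them by the adjoint of another lies in the corner. *)
Definition LSab_row (l : L) : Prop := (exists v, l = v0 v) \/ (exists e, l = ed e).

Section VertexCorner.
Variable h : B -> L.
Hypothesis hH : star_hom h.
Hypothesis hp : forall v, h (p v) = v0 v.
Hypothesis htau :
  forall (e f : bedge F) (ef : btgt e = btgt f), h (tau ef) = ed e ** (ed f)^*.

Lemma LVab_image_corner x : corner_set (fun v => v0 v) (h x).
Proof.
elim/tame_pres_ind: x => [[v|e f ef]||x y Cx Cy|k x Cx|x y Cx Cy|x Cx].
- rewrite [h _]hp; apply: lspan_in; exists v, v, (v0 v).
  by rewrite !LSab_vv eqxx !scale1r LSab_vv eqxx scale1r.
- rewrite [h _]htau; apply: lspan_in; exists (bsrc e), (bsrc f), (ed e ** (ed f)^*).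
  rewrite sa_mulA LSab_src -sa_mulA; congr (_ ** _).
  by rewrite -[in RHS]LSab_vertex_star -sa_starM LSab_src.
- by rewrite (hom_zero hH); apply: lspan_0.
- by rewrite (hom_add hH); apply: lspan_D.
- by rewrite (hom_scale hH); apply: lspan_Z.
- by rewrite (hom_mul hH); apply: corner_mul.
- by rewrite (hom_star hH); apply: corner_star => // v; apply: LSab_vertex_star.
Qed.

(** The representation by matrices composed with h is the (None,None) entry. *)
Lemma LVab_image_inj : injective h.
Proof.
have [rho rhoH [rhov rhoe]] := LSab_matrices.
have diagH : star_hom (M None None) by apply: entry_diag_hom.
have M_inj : injective (M None None) by apply: entry_inj.
have rhoh : rho \o h =1 M None None.
  apply: (tame_pres_hom_eq (hom_comp hH rhoH) diagH) => -[v|e f ef] /=.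
    by rewrite [X in rho X]hp rhov.
  by rewrite [X in rho X]htau rhoe.
by move=> x y xy; apply: M_inj; rewrite -!rhoh /= xy.
Qed.

(** A product e f^* is the image of tau(e,f) when the targets agree, and is zero
    otherwise, as are v e^* and e v for v in the first part. *)
Lemma LSab_row_mul l l' : LSab_row l -> LSab_row l' -> exists b, l ** l'^* = h b.
Proof.
have mul0 (v : bvertex0 F) e : v0 v ** (ed e)^* = 0.
  rewrite -(LSab_tgt e) sa_starM sa_mulA LSab_vertex_star LSab_vv /=.
  by rewrite scale0r sa_mul0l.
move=> [[v ->]|[e ->]] [[v' ->]|[e' ->]].
- rewrite LSab_vertex_star LSab_vv; exists ((v == v')%:R *: p v).
  by rewrite (hom_scale hH) hp.
- by exists 0; rewrite (hom_zero hH) mul0.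
- by exists 0; rewrite (hom_zero hH) -[_ ** _]sa_starK sa_starM sa_starK mul0 sa_star0.
- case: (btgt e =P btgt e') => [ee'|ee']; first by exists (tau ee'); rewrite htau.
  exists 0; rewrite (hom_zero hH) -(LSab_tgt e) -(LSab_tgt e') sa_starM.
  rewrite sa_mulA -(sa_mulA (ed e)) LSab_vertex_star LSab_vv.
  rewrite (inj_eq (@inr_inj _ _)); case: eqP => // _.
  by rewrite scale0r sa_mul0r sa_mul0l.
Qed.

Definition LSab_blocks : set L := lspan [set z | exists l b l',
  [/\ LSab_row l, LSab_row l' & z = l^* ** h b ** l']]%classic.

(** Since a product of a row and the adjoint of a row is in the image of h, the
    span is a subalgebra; it contains the generators because every vertex of the
    second part is e^* e for some edge e. *)
Lemma LSab_blocks_all x : LSab_blocks x.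
Proof.
have S_gen l b l' : LSab_row l -> LSab_row l' -> LSab_blocks (l^* ** h b ** l').
  by move=> rl rl'; apply: lspan_in; exists l, b, l'.
have row_v v : LSab_row (v0 v) by left; exists v.
have row_e e : LSab_row (ed e) by right; exists e.
have SM u y : LSab_blocks u -> LSab_blocks y -> LSab_blocks (u ** y).
  move=> Su; elim=> {y} [_ [l [b [l' [rl rl' ->]]]]||y z _ Sy _ Sz|k y _ Sy].
  - elim: Su => {u} [_ [m [c [m' [rm rm' ->]]]]||u z _ Su _ Sz|k u _ Su].
    + have [d dE] := LSab_row_mul rm' rl.
      have -> : m^* ** h c ** m' ** (l^* ** h b ** l') = m^* ** h (c ** d ** b) ** l'.
        by rewrite !(hom_mul hH) -dE !sa_mulA.
      exact: S_gen.
    + by rewrite sa_mul0l; apply: lspan_0.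
    + by rewrite sa_mulDl; apply: lspan_D.
    + by rewrite sa_scalel; apply: lspan_Z.
  - by rewrite sa_mul0r; apply: lspan_0.
  - by rewrite sa_mulDr; apply: lspan_D.
  - by rewrite sa_scaler; apply: lspan_Z.
have SS u : LSab_blocks u -> LSab_blocks u^*.
  elim=> {u} [_ [l [b [l' [rl rl' ->]]]]||u y _ Su _ Sy|k u _ Su].
  - by rewrite !sa_starM sa_starK sa_mulA -(hom_star hH); apply: S_gen.
  - by rewrite sa_star0; apply: lspan_0.
  - by rewrite sa_starD; apply: lspan_D.
  - by rewrite sa_starZ; apply: lspan_Z.
have ed_pisom e : ed e ** (ed e)^* ** ed e = ed e.
  by rewrite -sa_mulA (ef_norm LSab_edge_family) LSab_tgt.
have vv v : v0 v ** v0 v = v0 v by rewrite LSab_vv eqxx scale1r.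
have Se e : LSab_blocks (ed e).
  have -> : ed e = (v0 (bsrc e))^* ** h (tau (erefl (btgt e))) ** ed e.
    by rewrite htau LSab_vertex_star sa_mulA LSab_src ed_pisom.
  exact: S_gen.
elim/tame_pres_ind: x => [[[v|w]|e]||x y Sx Sy|k x Sx|x y Sx Sy|x Sx].
- have -> : tgen _ (@LSv F (inl v)) = (v0 v)^* ** h (p v) ** v0 v.
    by rewrite hp LSab_vertex_star !vv.
  exact: S_gen.
- have [e <-] := tgt_surj w.
  have -> : tgen _ (@LSv F (inr (btgt e))) = (ed e)^* ** ed e.
    by rewrite (ef_norm LSab_edge_family).
  by apply: SM; [apply: SS|]; apply: Se.
- exact: Se.
- exact: lspan_0.
- exact: lspan_D.
- exact: lspan_Z.
- exact: SM.
- exact: SS.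
Qed.

(** For x = l^* b r the outer factors of p x p' combine with l^* and r to give
    elements of the image. *)
Lemma LVab_image_onto x : corner_set (fun v => v0 v) x -> exists b, h b = x.
Proof.
have row_v v : LSab_row (v0 v) by left; exists v.
elim=> {x} [_ [v [v' [x ->]]]||x y _ [b <-] _ [c <-]|k x _ [b <-]].
- elim: (LSab_blocks_all x) =>
    {x} [_ [l [b [l' [rl rl' ->]]]]||x y _ [b bE] _ [c cE]|k x _ [b bE]].
  + have [c cE] := LSab_row_mul (row_v v) rl.
    have [d dE] := LSab_row_mul rl' (row_v v').
    exists (c ** b ** d); rewrite !(hom_mul hH) -cE -dE LSab_vertex_star.
    by rewrite !sa_mulA.
  + by exists 0; rewrite (hom_zero hH) sa_mul0r sa_mul0l.
  + by exists (b + c); rewrite (hom_add hH) bE cE sa_mulDr sa_mulDl.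
  + by exists (k *: b); rewrite (hom_scale hH) bE sa_scaler sa_scalel.
- by exists 0; rewrite (hom_zero hH).
- by exists (b + c); rewrite (hom_add hH).
- by exists (k *: b); rewrite (hom_scale hH).
Qed.

End VertexCorner.

Lemma LVab_iso_corner : exists2 psi : B -> Vcorner conj F, star_iso psi &
  (forall v, subval (psi (p v)) = v0 v) /\
  (forall e f (ef : btgt e = btgt f), subval (psi (tau ef)) = ed e ** (ed f)^*).
Proof.
have WT := tame_words_tame (LS_rel (conj := conj) (F := F)).
have Wv v : tame_words (v0 v) by apply: (tgen_word _ (LSv _)).
have We e : tame_words (ed e) by apply: (tgen_word _ (@LSe F e)).
have [h hH [hp htau]] := LVab_lift finF LSab_edge_family WT Wv We.
have [psi psiH psiE] :=
  subalg_lift (S := corner_sub (fun v => LSab_vertex_star conj (F := F) (inl v))) hH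
    (LVab_image_corner hH hp htau).
exists psi; last by split=> [v|e f ef]; rewrite psiE.
split=> //; rewrite -setTT_bijective; split=> // [x y _ _ xy|x _].
  by apply: (LVab_image_inj hH hp htau); rewrite -!psiE xy.
have [b bE] := LVab_image_onto hH hp htau (asboolW (subvalP x)).
by exists b => //; apply: val_inj; rewrite /= psiE.
Qed.

End CornerIso.

(** * The two isomorphisms *)

Theorem theorem4p4 (K : fieldType) (conj : involutive_rmorphism K)
    (E : weighted_graph) (E_lf : locally_finite E) :
  exists (phi : Lab conj E -> LVab conj (E1 E))
         (psi : LVab conj (E1 E) -> Vcorner conj (E1 E)),
    [/\ star_iso phi,
        star_iso psi,
        (forall v : vertex E, phi (Lab_vertex conj v) = LVab_p conj (F := E1 E) v)
        /\ (forall (e : edge E) (i : 'I_(weight e)),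
              phi (Lab_edge conj i)
              = LVab_tau conj (F := E1 E) (e := alpha_up i) (f := alpha_dn i) erefl)
      & (forall v : bvertex0 (E1 E),
           subval (psi (LVab_p conj v)) = LSab_vertex conj (F := E1 E) (inl v))
        /\ (forall (x y : bedge (E1 E)) (xy : btgt x = btgt y),
              subval (psi (LVab_tau conj xy))
              = LSab_edge conj (F := E1 E) x ** (LSab_edge conj (F := E1 E) y)^*)].
Proof.
have [phi phi_iso phiE] := Lab_iso_LVab conj E_lf.
have [psi psi_iso psiE] :=
  LVab_iso_corner conj (F := E1 E) (E1_sep_finite E_lf) (@E1_tgt_surj E).
by exists phi, psi.
Qed.
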